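(* Let $n\ge1$ and suppose $\alpha_{\boldsymbol N}(a,b)$ and $\beta_{\boldsymbol N}(a,b)$ form a WP Bailey pair with respect to the matrix $\mathbf B^{(1)}$. For complex parameters $\rho_1,\rho_2$ let \begin{align*} \alpha'_{\boldsymbol N}(a,b)&:=\frac{(\rho_1,\,\rho_2;q,p)_{|\boldsymbol N|}}{\prod_{r=1}^n(ax_rq/\rho_1,\,ax_rq/\rho_2;q,p)_{N_r}}\left(\frac{aq}{\rho_1\rho_2}\right)^{|\boldsymbol N|}\prod_{r=1}^nx_r^{N_r}\cdot q^{-\sum_{r<s}N_rN_s}\,\alpha_{\boldsymbol N}\big(a,b\rho_1\rho_2/(aq)\big),\\ \beta'_{\boldsymbol N}(a,b)&:=\prod_{r=1}^n\frac{(b\rho_1x_r/a,\,b\rho_2x_r/a;q,p)_{N_r}}{(ax_rq/\rho_1,\,ax_rq/\rho_2;q,p)_{N_r}}\sum_{\substack{0\le k_r\le N_r\\ r=1,\dots,n}}\Bigg(\frac{(\rho_1,\,\rho_2;q,p)_{|\boldsymbol k|}}{\prod_{r=1}^n(b\rho_1x_r/a,\,b\rho_2x_r/a;q,p)_{k_r}}\\ &\quad\times\prod_{r=1}^n\frac{\theta(b\rho_1\rho_2x_rq^{k_r+|\boldsymbol k|}/(aq);p)}{\theta(b\rho_1\rho_2x_r/(aq);p)}\frac{(ax_rq^{1+k_r-|\boldsymbol k|}/(\rho_1\rho_2);q,p)_{N_r-k_r}}{(b\rho_1\rho_2x_r/a;q,p)_{N_r+|\boldsymbol k|}}\\ &\quad\times\frac{\prod_{r,s=1}^n(bx_rx_s;q,p)_{N_s+k_r}}{\prod_{1\le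 r<s\le n}(bx_rx_s;q,p)_{k_r+k_s}\prod_{r,s=1}^n(q^{1+k_r-k_s}x_r/x_s;q,p)_{N_r-k_r}}\\ &\quad\times\left(\frac{aq}{\rho_1\rho_2}\right)^{|\boldsymbol k|}\prod_{r=1}^nx_r^{k_r}\cdot q^{-\sum_{r<s}k_rk_s}\,\beta_{\boldsymbol k}\big(a,b\rho_1\rho_2/(aq)\big)\Bigg). \end{align*} Then $\alpha'_{\boldsymbol N}(a,b)$ and $\beta'_{\boldsymbol N}(a,b)$ form a WP Bailey pair with respect to $\mathbf B^{(4)}$.
   Context: Let $q,p$ be complex numbers with $q\neq 0$ and $|p|<1$. For $a\ne 0$ put $\theta(a;p)=\prod_{j\ge 0}(1-ap^j)(1-p^{j+1}/a)$. For an integer $k$ the $q,p$-shifted factorial is $(a;q,p)_k=\prod_{j=0}^{k-1}\theta(aq^j;p)$ if $k\ge 0$ (empty product $=1$), and $(a;q,p)_{k}=\big(\prod_{j=k}^{-1}\theta(aq^{j};p)\big)^{-1}$ if $k<0$. Write $(a_1,\dots,a_m;q,p)_k=(a_1;q,p)_k\cdots(a_m;q,p)_k$. For a tuple $\boldsymbol k=(k_1,\dots,k_n)$, $|\boldsymbol k|=k_1+\cdots+k_n$; $\sum_{r<s}$ is over $1\le r<s\le n$. The $x_1,\dots,x_n$ are fixed complex parameters. All parameters are nonzero and generic in the sense that no denominators vanish. WP Bailey pair: given a matrix $\mathbf B=(B_{\boldsymbol k\boldsymbol j}(a,b))$ indexed by $n$-tuples of nonnegative integers, two sequences $\alpha_{\boldsymbol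 N}(a,b)$ and $\beta_{\boldsymbol N}(a,b)$ (indexed by $n$-tuples of nonnegative integers and depending on parameters $a,b$) form a WP Bailey pair with respect to $\mathbf B$ if for all $\boldsymbol N$ and all (generic) $a,b$ $$\beta_{\boldsymbol N}(a,b)=\sum_{0\le j_r\le N_r,\ r=1,\dots,n}B_{\boldsymbol N\boldsymbol j}(a,b)\,\alpha_{\boldsymbol j}(a,b).$$ The matrices $\mathbf B^{(1)}$ and $\mathbf B^{(4)}$ have entries $$B^{(1)}_{\boldsymbol k\boldsymbol j}(a,b)=\frac{(b/a;q,p)_{|\boldsymbol k|-|\boldsymbol j|}}{\prod_{r,s=1}^n(q^{1+j_r-j_s}x_r/x_s;q,p)_{k_r-j_r}}\prod_{r=1}^n\frac{(bx_r;q,p)_{j_r+|\boldsymbol k|}}{(ax_rq;q,p)_{k_r+|\boldsymbol j|}},$$ $$B^{(4)}_{\boldsymbol k\boldsymbol j}(a,b)=\frac{\prod_{r,s=1}^n(bx_rx_s;q,p)_{k_r+j_s}}{\prod_{1\le r<s\le n}(bx_rx_s;q,p)_{j_r+j_s}\prod_{r,s=1}^n(q^{1+j_r-j_s}x_r/x_s;q,p)_{k_r-j_r}}\prod_{r=1}^n\frac{(bx_r/a;q,p)_{k_r-|\boldsymbol j|}}{(bx_r/a;q,p)_{j_r-|\boldsymbol j|}(ax_rq;q,p)_{k_r+|\boldsymbol j|}}.$$ *)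

(* Defs.v *)
From HB Require Import structures.
From mathcomp Require Import all_boot all_order all_algebra.
From mathcomp Require Import complex.
From mathcomp Require Import all_classical all_reals all_analysis.

Set Implicit Arguments.
Unset Strict Implicit.
Unset Printing Implicit Defensive.

Import Order.TTheory GRing.Theory Num.Theory.
Import numFieldNormedType.Exports.
Local Open Scope classical_set_scope.
Local Open Scope ring_scope.

(* n-tuples of nonnegative integers. *)
Definition multi (n : nat) := {ffun 'I_n -> nat}.

Section Multi.
Context {n : nat}.
Implicit Types k : multi n.

Definition msize k : nat := (\sum_(r < n) k r)%N.

Definition mcross k : nat := (\sum_(r < n) \sum_(s < n | (r < s)%N) k r * k s)%N.

Definition mle (j k : multi n) : bool := [forall r, (j r <= k r)%N].

(* The sum of F k over the k with 0 <= k_r <= N_r for every r. *)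
Definition box_sum (V : nmodType) (N : multi n) (F : multi n -> V) : V :=
  \sum_(k : {dffun forall r : 'I_n, 'I_(N r).+1}) F [ffun r => k r : nat].

End Multi.

Section Factorials.
Context {C : numFieldType}.
Implicit Types (a q p : C) (k : int).

Definition theta p a : C :=
  lim ((\prod_(0 <= j < m) ((1 - a * p ^+ j) * (1 - p ^+ j.+1 / a)))
         @[m --> \oo]).

(* For k = Negz m = - (m + 1) the product over k <= j <= -1 is reindexed by
   j = - (i + 1).  Since 0^-1 = 0, at a negative index qpfact q p a k is
   nonzero exactly when the expression it stands for is well defined. *)
Definition qpfact q p a k : C :=
  match k with
  | Posz m => \prod_(i < m) theta p (a * q ^+ i)
  | Negz m => (\prod_(i < m.+1) theta p (a * q ^- i.+1))^-1
  end.

End Factorials.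

Section BaileyPairs.
Context {C : numFieldType} {n : nat}.
Variables (q p : C) (x : 'I_n -> C).
Implicit Types (a b : C) (j k N : multi n) (B : multi n -> multi n -> C -> C -> C).
Implicit Types (alpha beta : multi n -> C -> C -> C).

Local Notation "a `_[ k ]" := (qpfact q p a k)
  (at level 8, k at level 99, format "a `_[ k ]").

(* G is the set of generic parameter values (a, b) on which the pair of
   sequences is considered. *)
Definition WP_Bailey_pair (G : C -> C -> Prop) B alpha beta : Prop :=
  forall a b, G a b -> forall N,
    beta N a b = box_sum N (fun j => B N j a b * alpha j a b).

Definition xfact k j : C :=
  \prod_(r < n) \prod_(s < n)
    (q ^ (1 + (j r)%:Z - (j s)%:Z) * x r / x s)`_[(k r)%:Z - (j r)%:Z].

Definition B1 k j a b : C :=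
  (b / a)`_[(msize k)%:Z - (msize j)%:Z] / xfact k j
  * \prod_(r < n) ((b * x r)`_[(j r + msize k)%N]
                   / (a * x r * q)`_[(k r + msize j)%N]).

Definition B4 k j a b : C :=
  (\prod_(r < n) \prod_(s < n) (b * x r * x s)`_[(k r + j s)%N])
  / ((\prod_(r < n) \prod_(s < n | (r < s)%N) (b * x r * x s)`_[(j r + j s)%N])
     * xfact k j)
  * \prod_(r < n) ((b * x r / a)`_[(k r)%:Z - (msize j)%:Z]
                   / ((b * x r / a)`_[(j r)%:Z - (msize j)%:Z]
                      * (a * x r * q)`_[(k r + msize j)%N])).

Variables (rho1 rho2 : C).

Definition alpha' alpha N a b : C :=
  rho1`_[msize N] * rho2`_[msize N]
  / (\prod_(r < n) ((a * x r * q / rho1)`_[N r] * (a * x r * q / rho2)`_[N r]))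
  * (a * q / (rho1 * rho2)) ^+ msize N
  * (\prod_(r < n) x r ^+ N r) * q ^- mcross N
  * alpha N a (b * rho1 * rho2 / (a * q)).

Definition beta' beta N a b : C :=
  (\prod_(r < n) ((b * rho1 * x r / a)`_[N r] * (b * rho2 * x r / a)`_[N r]
                  / ((a * x r * q / rho1)`_[N r] * (a * x r * q / rho2)`_[N r])))
  * box_sum N (fun k =>
      rho1`_[msize k] * rho2`_[msize k]
      / (\prod_(r < n)
           ((b * rho1 * x r / a)`_[k r] * (b * rho2 * x r / a)`_[k r]))
      * (\prod_(r < n)
           (theta p (b * rho1 * rho2 * x r * q ^+ (k r + msize k) / (a * q))
            / theta p (b * rho1 * rho2 * x r / (a * q))
            * ((a * x r * q ^ (1 + (k r)%:Z - (msize k)%:Z)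
                 / (rho1 * rho2))`_[(N r)%:Z - (k r)%:Z]
               / (b * rho1 * rho2 * x r / a)`_[(N r + msize k)%N])))
      * ((\prod_(r < n) \prod_(s < n) (b * x r * x s)`_[(N s + k r)%N])
         / ((\prod_(r < n) \prod_(s < n | (r < s)%N)
               (b * x r * x s)`_[(k r + k s)%N])
            * xfact N k))
      * (a * q / (rho1 * rho2)) ^+ msize k
      * (\prod_(r < n) x r ^+ k r) * q ^- mcross k
      * beta k a (b * rho1 * rho2 / (a * q))).

(* Nonvanishing of the denominators that involve only the fixed x_r. *)
Definition generic_x : Prop :=
  forall j k, mle j k -> xfact k j != 0.

(* Nonvanishing of all other denominators of B1 at (a, b rho1 rho2 / (a q)),
   of B4 at (a, b), and of alpha' and beta' at (a, b).  A factor (c)_m with m a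
   difference of the form j_r - |j| is a denominator or has one itself; see
   qpfact. *)
Definition generic_ab a b : Prop :=
  [/\ a != 0 /\ b != 0,
      forall (r : 'I_n) (m : nat),
        [/\ (a * x r * q)`_[m] != 0,
            (a * x r * q / rho1)`_[m] != 0 /\ (a * x r * q / rho2)`_[m] != 0,
            (b * rho1 * x r / a)`_[m] != 0 /\ (b * rho2 * x r / a)`_[m] != 0 &
            (b * rho1 * rho2 * x r / a)`_[m] != 0],
      forall r : 'I_n, theta p (b * rho1 * rho2 * x r / (a * q)) != 0,
      forall (r s : 'I_n) (m : nat), (r < s)%N -> (b * x r * x s)`_[m] != 0 &
      forall j (r : 'I_n), (b * x r / a)`_[(j r)%:Z - (msize j)%:Z] != 0].

End BaileyPairs.

(* Main.v *)
Require Import Defs.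
From mathcomp Require Import all_boot all_order all_algebra.
From mathcomp Require Import complex.
From mathcomp Require Import all_classical all_reals all_analysis.
From mathcomp Require Import ring lra zify.

Set Implicit Arguments.
Unset Strict Implicit.
Unset Printing Implicit Defensive.

Import Order.TTheory GRing.Theory Num.Theory.
Import numFieldNormedType.Exports.
Import ComplexField.Normc.
Local Open Scope classical_set_scope.
Local Open Scope ring_scope.
Local Open Scope complex_scope.

(** Inserting the given pair into beta' and exchanging the two sums, the claim
    says that for every j <= N the sum over j <= k <= N of the coefficient of
    beta_k in beta'_N times B1_{kj} equals B4_{Nj} times the coefficient of
    alpha_j in alpha'_j ([beta_coef_sum]). Put c = b rho1 rho2 / (a q). After the
    substitutions x_r -> x_r q^{j_r}, c -> c q^{|j|}, N -> N - j the sum starts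
    at 0, and it is the elliptic Jackson sum of type D_n ([Jackson_sum_Dn]) with
    free parameters d = rho1 q^{|j|}, e = rho2 q^{|j|}, f = c / a, tied by the
    balancing condition b d e f = c^2 q and entering symmetrically.

    The Jackson sum is proved by induction on |N|. Fix e and the product
    lam = d f. After clearing denominators, d occurs only through products
    theta (t d) theta (t lam / d), and for fixed lam all of these are linear
    combinations of two functions of d ([theta_rank2], a form of the addition
    formula). Hence both sides are binary forms of degree |N| in these two
    functions, and it suffices to compare them at |N| + 1 points with pairwise
    nonproportional values ([Jackson_interpolation]). At d = 1 only the term
    k = 0 survives ([Jackson_at1]). At d = c x_r q^{i+1} with i < N_r the terms
    with k_r <= i vanish, and the others form a Jackson sum for N with N_r
    lowered by i + 1 ([Jackson_step]). These points are independent if e avoids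
    the zeros of finitely many theta functions; for the other e one interpolates
    once more, at generic values of d, where the symmetry in d and e applies.

    The two-dimensionality comes from the Jacobi triple product: it turns
    theta X * theta Y into a double series over (k, l) with quadratic exponents,
    and in the coordinates k + l and k - l this series splits into two products
    of a function of X Y and a function of X / Y. The triple product itself is
    the limit of the q-binomial theorem. *)

(** * Convergence of complex sequences *)

(** The topology used to define theta is attached to the projection of a
    [numFieldType]; naming the structure keeps that projection visible, so that
    convergence in R[i] can be written. *)
Definition Cx (R : realType) : numFieldType := R[i].

Section Modulus.
Variable R : realType.
Local Notation C := (Cx R).
Implicit Types (z w : C) (u f : nat -> C) (D r : R).

(** Values in R rather than in C: estimates can then be closed by the
    arithmetic tactics for real domains. *)
Definition modulus z : R := normc z.

Lemma modulus_ge0 z : 0 <= modulus z.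
Proof. by case: z => a b; exact: sqrtr_ge0. Qed.

Lemma Re_le_modulus z : `|complex.Re z| <= modulus z.
Proof.
by case: z => a b; rewrite /modulus /= -sqrtr_sqr ler_wsqrtr // lerDl sqr_ge0.
Qed.

Lemma Im_le_modulus z : `|complex.Im z| <= modulus z.
Proof.
by case: z => a b; rewrite /modulus /= -sqrtr_sqr ler_wsqrtr // lerDr sqr_ge0.
Qed.

Lemma modulus_le z : modulus z <= `|complex.Re z| + `|complex.Im z|.
Proof.
case: z => a b; rewrite /modulus /= -(@ger0_norm _ (`|a| + `|b|)) ?addr_ge0 //.
rewrite -[leRHS]sqrtr_sqr ler_wsqrtr // sqrrD !real_normK ?num_real // addrAC lerDl.
by rewrite mulrn_wge0 // mulr_ge0.
Qed.

Lemma normrcE z : `|z| = (modulus z)%:C.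
Proof. by []. Qed.

Lemma modulus0 : modulus 0 = 0. Proof. exact: normc0. Qed.

Lemma modulus1 : modulus 1 = 1. Proof. exact: normc1. Qed.

Lemma modulusM z w : modulus (z * w) = modulus z * modulus w.
Proof. exact: normcM. Qed.

Lemma modulusD z w : modulus (z + w) <= modulus z + modulus w.
Proof. exact: le_normcD. Qed.

Lemma modulusN z : modulus (- z) = modulus z.
Proof. exact: normcN. Qed.

Lemma modulusB z w : modulus (z - w) <= modulus z + modulus w.
Proof. by rewrite -(modulusN w) modulusD. Qed.

Lemma modulusV z : modulus z^-1 = (modulus z)^-1.
Proof. exact: normcV. Qed.

Lemma modulus_eq0 z : (modulus z == 0) = (z == 0).
Proof.
apply/eqP/eqP => [|->]; last exact: modulus0.
exact: eq0_normc.
Qed.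

Lemma modulus_gt0 z : (0 < modulus z) = (z != 0).
Proof. by rewrite lt0r modulus_ge0 modulus_eq0 andbT. Qed.

Lemma modulusX z n : modulus (z ^+ n) = modulus z ^+ n.
Proof.
elim: n => [|n IH]; first by rewrite !expr0 modulus1.
by rewrite !exprS modulusM IH.
Qed.

Lemma modulus_prod (I : Type) (s : seq I) (P : pred I) (F : I -> C) :
  modulus (\prod_(i <- s | P i) F i) = \prod_(i <- s | P i) modulus (F i).
Proof. by apply: (big_morph _ modulusM modulus1). Qed.

Lemma modulus_sum (I : Type) (s : seq I) (P : pred I) (F : I -> C) :
  modulus (\sum_(i <- s | P i) F i) <= \sum_(i <- s | P i) modulus (F i).
Proof.
elim/big_rec2: _ => [|i x y _ le]; first by rewrite modulus0.
by rewrite (le_trans (modulusD _ _)) // lerD2l.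
Qed.

Lemma modulus_squeeze u (l : C) (v : nat -> R) :
  (forall m, modulus (u m - l) <= v m) -> v @ \oo --> (0 : R) -> u @ \oo --> l.
Proof.
move=> le /cvgrPdist_lt v0; apply/cvgrPdist_lt => eps eps0.
have [e e0 ->] : exists2 e : R, 0 < e & eps = e%:C.
  by case: eps eps0 => x y; rewrite ltcE /= => /andP[/eqP -> x0]; exists x.
have := v0 _ e0; apply: filterS => m; rewrite sub0r normrN => vm.
rewrite distrC normrcE ltcR (le_lt_trans (le m)) //.
exact: le_lt_trans (ler_norm _) vm.
Qed.

Lemma modulus_cvg0 u (l : C) : u @ \oo --> l -> (fun m => modulus (u m - l)) @ \oo --> (0 : R).
Proof.
move=> /cvgrPdist_lt ul; apply/cvgrPdist_lt => e e0.
have e0' : 0 < e%:C by rewrite ltcR.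
have := ul _ e0'; apply: filterS => m.
by rewrite distrC normrcE ltcR sub0r normrN ger0_norm // modulus_ge0.
Qed.

Lemma geometric_cvg0 D r : 0 <= r < 1 -> (fun m => D * r ^+ m) @ \oo --> (0 : R).
Proof.
move=> /andP[r0 r1]; have := @cvg_geometric R D r; apply.
by rewrite ger0_norm.
Qed.

(** The increments are dominated by a geometric series, so the sequence is
    the partial sum of an absolutely convergent series. *)
Lemma cvgR_geometric (u : nat -> R) D r : 0 <= r < 1 ->
  (forall m, `|u m.+1 - u m| <= D * r ^+ m) -> exists l : R, u @ \oo --> l.
Proof.
move=> /andP[r0 r1] le.
have c1 : cvgn (series (fun m => `|u m.+1 - u m|)).
  apply: (@series_le_cvg R _ (geometric D r)) => // [m|].
    by rewrite (le_trans _ (le m)).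
  by apply: is_cvg_geometric_series; rewrite ger0_norm.
have c2 : cvgn (series (fun m => u m.+1 - u m)) by exact: normed_cvg.
set s := series _ in c2; exists (u 0%N + limn s).
have E : (fun m => u 0%N + s m) = u.
  by apply/funext => m; rewrite /s seriesEnat /= telescope_sumr // addrC subrK.
by rewrite -[X in X @ _]E; apply: cvgD c2; exact: cvg_cst.
Qed.

(** Completeness of C in the only form needed below, obtained from the real and
    imaginary parts. *)
Lemma cvgC_geometric u D r : 0 <= r < 1 ->
  (forall m, modulus (u m.+1 - u m) <= D * r ^+ m) -> exists l : C, u @ \oo --> l.
Proof.
move=> rr le.
have [|a ha] := @cvgR_geometric (fun m => complex.Re (u m)) D r rr.
  move=> m; apply: le_trans (le m); apply: le_trans (Re_le_modulus _).
  by case: (u m.+1) => ? ?; case: (u m).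
have [|b hb] := @cvgR_geometric (fun m => complex.Im (u m)) D r rr.
  move=> m; apply: le_trans (le m); apply: le_trans (Im_le_modulus _).
  by case: (u m.+1) => ? ?; case: (u m).
exists (a +i* b).
apply: (@modulus_squeeze _ _ (fun m => `|complex.Re (u m) - a| + `|complex.Im (u m) - b|)).
  move=> m; apply: le_trans (modulus_le _) _.
  by case: (u m) => x y.
rewrite -[0]addr0; apply: cvgD.
  apply/norm_cvg0P; rewrite -(subrr a); apply: cvgB => //; exact: cvg_cst.
apply/norm_cvg0P; rewrite -(subrr b); apply: cvgB => //; exact: cvg_cst.
Qed.

End Modulus.

(** * Infinite products *)

Section InfiniteProducts.
Variable R : realType.
Local Notation C := (Cx R).
Implicit Types (z w : C) (f : nat -> C) (D r : R).

(** Weierstrass' inequality. *)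
Lemma prod1B_ge (u : nat -> R) m : (forall i, 0 <= u i <= 1) ->
  1 - \sum_(i < m) u i <= \prod_(i < m) (1 - u i) <= 1.
Proof.
move=> u01; elim: m => [|m /andP[IH1 IH2]]; first by rewrite !big_ord0 subr0 lexx.
rewrite !big_ord_recr /=; have /andP[u0 u1] := u01 m.
have s0 : 0 <= \sum_(i < m) u i by apply: sumr_ge0 => i _; case/andP: (u01 i).
have p0 : 0 <= \prod_(i < m) (1 - u i).
  by apply: prodr_ge0 => i _; rewrite subr_ge0; case/andP: (u01 i).
by apply/andP; split; nra.
Qed.

Lemma geometric_sum_le D r m : 0 <= D -> 0 <= r < 1 ->
  \sum_(i < m) D * r ^+ i <= D / (1 - r).
Proof.
move=> D0 /andP[r0 r1].
have -> : \sum_(i < m) D * r ^+ i = D * (1 - r ^+ m) / (1 - r).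
  elim: m => [|m IH]; first by rewrite big_ord0 expr0 subrr mulr0 mul0r.
  rewrite big_ord_recr /= IH exprS; field.
  by rewrite subr_eq0 eq_sym lt_eqF.
rewrite ler_wpM2r ?invr_ge0 ?subr_ge0 ?(ltW r1) // ler_piMr //.
by rewrite gerBl exprn_ge0.
Qed.

Lemma geometric_small D r e : 0 <= r < 1 -> 0 < e -> exists M, D * r ^+ M <= e.
Proof.
move=> rr e0; have /cvgrPdist_le/(_ _ e0)[M _ hM] := geometric_cvg0 D rr.
exists M; apply: le_trans (hM M (leqnn M)).
by rewrite sub0r normrN ler_norm.
Qed.

(** Once the remaining deviations u_i add up to at most 1/2, Weierstrass'
    inequality bounds the products of the 1 - u_i from below, and then
    (1 + u)(1 - u) <= 1 bounds those of the 1 + u_i from above. *)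
Lemma prod_tail D r (u : nat -> R) : 0 <= D -> 0 <= r < 1 ->
  (forall i, 0 <= u i <= D * r ^+ i) ->
  exists M, forall m,
    [/\ forall i, u (M + i)%N <= 1, 1 / 2 <= \prod_(i < m) (1 - u (M + i)%N) &
      \prod_(i < m) (1 + u (M + i)%N) <= 2].
Proof.
move=> D0 rr uD; case/andP: (rr) => r0 r1.
have r1' : 0 < 1 - r by rewrite subr_gt0.
have e0 : 0 < (1 - r) / 2 by rewrite divr_gt0.
have [M hM] := geometric_small D rr e0; exists M => m.
have DM0 : 0 <= D * r ^+ M by rewrite mulr_ge0 // exprn_ge0.
have uM i : 0 <= u (M + i)%N <= (D * r ^+ M) * r ^+ i.
  by rewrite -mulrA -exprD.
have rle i : r ^+ i <= 1 by apply: exprn_ile1; rewrite // ltW.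
have u1 i : 0 <= u (M + i)%N <= 1.
  have /andP[-> le] := uM i; apply: le_trans le _.
  have := rle i; have : 0 <= r ^+ i by rewrite exprn_ge0.
  move=> h1 h2; nra.
have S : \sum_(i < m) u (M + i)%N <= 1 / 2.
  apply: (@le_trans _ _ (\sum_(i < m) (D * r ^+ M) * r ^+ i)).
    by apply: ler_sum => i _; case/andP: (uM i).
  apply: le_trans (geometric_sum_le m DM0 rr) _.
  by rewrite ler_pdivrMr //; lra.
have /andP[lo hi] := prod1B_ge m u1.
have lo2 : 1 / 2 <= \prod_(i < m) (1 - u (M + i)%N) by apply: le_trans lo; lra.
split=> //; first by move=> i; case/andP: (u1 i).
have : \prod_(i < m) (1 + u (M + i)%N) * \prod_(i < m) (1 - u (M + i)%N) <= 1.
  rewrite -big_split /=; apply: prodr_ile1 => i _.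
  by have /andP[a b] := u1 i; apply/andP; split; nra.
have : 0 <= \prod_(i < m) (1 + u (M + i)%N).
  by apply: prodr_ge0 => i _; rewrite addr_ge0 //; case/andP: (u1 i).
move=> h1 h2; nra.
Qed.

Lemma prod1D_bounded D r (u : nat -> R) : 0 <= D -> 0 <= r < 1 ->
  (forall i, 0 <= u i <= D * r ^+ i) ->
  exists2 B, 0 <= B & forall m, \prod_(j < m) (1 + u j) <= B.
Proof.
move=> D0 r01 uD; have [M hM] := prod_tail D0 r01 uD.
have u0 j : 0 <= 1 + u j by rewrite addr_ge0 //; case/andP: (uD j).
exists ((\prod_(j < M) (1 + u j)) * 2) => [|m].
  by rewrite mulr_ge0 ?ler0n // prodr_ge0.
apply: (@le_trans _ _ (\prod_(j < m + M) (1 + u j))).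
  rewrite big_split_ord /= ler_peMr ?prodr_ge0 //.
  elim/big_ind: _ => [//|x y|j _]; first exact: mulr_ege1.
  by rewrite lerDl; case/andP: (uD (m + j)%N).
rewrite addnC big_split_ord /= ler_wpM2l ?prodr_ge0 //.
by have [] := hM m.
Qed.

Variables (f : nat -> C) (D r : R).
Hypotheses (D0 : 0 <= D) (r01 : 0 <= r < 1).
Hypothesis fD : forall j, modulus (f j - 1) <= D * r ^+ j.

Let u j := modulus (f j - 1).
Let uD j : 0 <= u j <= D * r ^+ j. Proof. by rewrite modulus_ge0 fD. Qed.

Let f_le j : modulus (f j) <= 1 + u j.
Proof. by have := modulusD (f j - 1) 1; rewrite subrK modulus1 addrC. Qed.

Let f_ge j : 1 - u j <= modulus (f j).
Proof.
have := modulusB (f j) (f j - 1); rewrite opprB addrCA subrr addr0 modulus1.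
by rewrite lerBlDr.
Qed.

Lemma infprod_bounded : exists2 B, 0 <= B & forall m, modulus (\prod_(j < m) f j) <= B.
Proof.
have [B B0 hB] := prod1D_bounded D0 r01 uD; exists B => // m.
apply: le_trans (hB m); rewrite modulus_prod.
by apply: ler_prod => j _; rewrite modulus_ge0 f_le.
Qed.

Lemma infprod_cvg : exists l : C, (fun m => \prod_(j < m) f j) @ \oo --> l.
Proof.
have [B B0 hB] := infprod_bounded.
apply: (@cvgC_geometric _ _ (B * D) r) => // m.
rewrite big_ord_recr /= -[X in _ - X]mulr1 -mulrBr modulusM -mulrA.
by rewrite ler_pM ?modulus_ge0 ?hB ?fD.
Qed.

(** Beyond a suitable index the partial products shrink by a factor of at most
    2, so the limit cannot vanish unless a factor does. *)
Lemma infprod_neq0 (l : C) : (forall j, f j != 0) ->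
  (fun m => \prod_(j < m) f j) @ \oo --> l -> l != 0.
Proof.
move=> f0 hl; have [M hM] := prod_tail D0 r01 uD.
pose b := modulus (\prod_(j < M) f j) / 2.
have b0 : 0 < b.
  by rewrite divr_gt0 // modulus_gt0; apply/prodf_neq0 => j _.
apply/eqP => l0; rewrite {l}l0 in hl.
have /cvgrPdist_lt/(_ _ b0)[K _ hK] := modulus_cvg0 hl.
have := hK (M + K)%N (leq_addl _ _).
rewrite /= subr0 sub0r normrN ger0_norm ?modulus_ge0 // big_split_ord /= modulusM.
rewrite ltNge => /negP[]; rewrite ler_wpM2l ?modulus_ge0 //.
have [u1 + _] := hM K; rewrite mul1r => /le_trans; apply.
rewrite modulus_prod; apply: ler_prod => j _.
by rewrite subr_ge0 u1 f_ge.
Qed.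

End InfiniteProducts.

(** * Zeros and inversion of the theta function *)

(** Two points of the annulus r < t <= 1 cannot differ by a nontrivial power of
    r: the annulus is a fundamental domain. *)
Lemma annulus_quotient (R : realType) (r A B : R) i j :
  0 < r -> r < 1 -> r < A -> A <= 1 -> r < B -> B <= 1 ->
  A * r ^+ i = B * r ^+ j -> A = B.
Proof.
move=> r0 r1; wlog ji : A B i j / (i <= j)%N => [hw|].
  move=> *; case/orP: (leq_total i j) => ?; first exact: (hw A B i j).
  by symmetry; apply: (hw B A j i).
move=> A0 A1 B0 B1; have rX n : 0 < r ^+ n <= 1 by rewrite exprn_gt0 // exprn_ile1 // ltW.
rewrite -(subnK ji) exprD mulrA => /mulIf; rewrite gt_eqF; last by have /andP[] := rX i.
move=> /(_ isT); case: (j - i)%N => [|n]; first by rewrite expr0 mulr1.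
rewrite exprS => E; exfalso.
have /andP[n0 n1] := rX n.
have h1 : 0 <= (1 - B) * (r * r ^+ n) by rewrite mulr_ge0 ?subr_ge0 ?mulr_ge0 // ltW.
have h2 : 0 <= r * (1 - r ^+ n) by rewrite mulr_ge0 ?subr_ge0 // ltW.
move: h1 h2; rewrite mulrBl mulrBr mul1r mulr1 -E; lra.
Qed.

Lemma annulus_zero_uniq (R : realType) (r A B T : R) i j :
  0 <= r -> r < 1 -> 0 < T -> r < A -> A <= 1 -> r < B -> B <= 1 ->
  A * T * r ^+ j = 1 \/ A * T = r ^+ j.+1 ->
  B * T * r ^+ i = 1 \/ B * T = r ^+ i.+1 -> A * T = B * T.
Proof.
move=> r0 r1 T0 A0 A1 B0 B1.
have rX n : 0 <= r ^+ n <= 1 by rewrite exprn_ge0 //= exprn_ile1 // ltW.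
have mixed a b n m : r < a -> a <= 1 -> r < b -> b <= 1 ->
    a * T * r ^+ n = 1 -> b * T = r ^+ m.+1 -> False.
  move=> a0 a1 b0 b1 h h'; move: h'; rewrite exprS.
  have /andP[x0 x1] := rX m; have /andP[y0 y1] := rX n => h'.
  have aT : 1 <= a * T by rewrite -h ler_piMr // mulr_ge0 // ltW // (le_lt_trans r0).
  have : 1 <= T by nra.
  nra.
have [r_eq0|r_neq0] := eqVneq r 0.
  have F a n : r < a -> a * T * r ^+ n = 1 \/ a * T = r ^+ n.+1 -> a * T = 1.
    rewrite r_eq0 => a0; case: n => [|n] [].
    - by rewrite expr0 mulr1.
    - by rewrite expr1 => /eqP; rewrite gt_eqF // mulr_gt0.
    - by rewrite expr0n mulr0 => /esym/eqP; rewrite oner_eq0.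
    - by rewrite expr0n => /eqP; rewrite gt_eqF // mulr_gt0.
  by move=> /(F _ _ A0) -> /(F _ _ B0) ->.
have rp : 0 < r by rewrite lt0r r_neq0.
have T1 : T != 0 by rewrite gt_eqF.
move=> [hj|hj] [hi|hi].
- congr (_ * T); apply: (@annulus_quotient _ r _ _ j i) => //.
  by apply: (mulIf T1); rewrite mulrAC hj mulrAC hi.
- by have := mixed _ _ _ _ A0 A1 B0 B1 hj hi.
- by have := mixed _ _ _ _ B0 B1 A0 A1 hi hj.
- congr (_ * T); apply: (@annulus_quotient _ r _ _ i.+1 j.+1) => //.
  by apply: (mulIf T1); rewrite mulrAC hj mulrAC hi mulrC.
Qed.

Section ThetaFunction.
Variable R : realType.
Local Notation C := (Cx R).
Variable p : C.
Hypothesis hp : `|p| < 1.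
Implicit Types (a z : C).

Local Notation r := (modulus p).

Lemma modulus_nome : 0 <= r < 1.
Proof. by rewrite modulus_ge0 /=; move: hp; rewrite normrcE -[1]/(1%:C) ltcR. Qed.

Lemma nome_exp_le1 j : r ^+ j <= 1.
Proof. by have /andP[? /ltW ?] := modulus_nome; apply: exprn_ile1. Qed.

Let factor a j : C := (1 - a * p ^+ j) * (1 - p ^+ j.+1 / a).

Let factor_bound a j :
  modulus (factor a j - 1) <= (modulus a + modulus a^-1 + modulus (a / a)) * r ^+ j.
Proof.
have -> : factor a j - 1 =
    - (a * p ^+ j) - a^-1 * p ^+ j * p + (a / a) * p ^+ j * p ^+ j.+1.
  by rewrite /factor exprS; ring.
apply: le_trans (modulusD _ _) _.
apply: le_trans (lerD (modulusB _ _) (lexx _)) _.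
rewrite modulusN !modulusM -modulusM !modulusX !mulrDl.
have /andP[r0 /ltW r1] := modulus_nome.
have rj : 0 <= r ^+ j by rewrite exprn_ge0.
rewrite [modulus (a * _)]modulusM modulusX !lerD //;
  by rewrite ler_piMr ?mulr_ge0 ?modulus_ge0 ?nome_exp_le1.
Qed.

Let bound_ge0 a : 0 <= modulus a + modulus a^-1 + modulus (a / a).
Proof. by rewrite !addr_ge0 ?modulus_ge0. Qed.

Definition theta_trunc a m : C := \prod_(j < m) factor a j.

Lemma theta_truncE a m : theta_trunc a m =
  \prod_(j < m) (1 - a * p ^+ j) * \prod_(j < m) (1 - p ^+ j.+1 / a).
Proof. by rewrite -big_split. Qed.

Lemma theta_cvg a : theta_trunc a @ \oo --> theta p a.
Proof.
have [l hl] := infprod_cvg (bound_ge0 a) modulus_nome (factor_bound a).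
rewrite /theta.
have -> : (fun m => \prod_(0 <= j < m) ((1 - a * p ^+ j) * (1 - p ^+ j.+1 / a)))
    = theta_trunc a by apply/funext => m; rewrite big_mkord.
by rewrite (cvg_lim _ hl).
Qed.

(** The product converges to 0 only if one of its factors vanishes, hence only
    at integral powers of the nome. *)
Lemma theta_zero a : a != 0 -> theta p a = 0 ->
  exists j, a * p ^+ j = 1 \/ a = p ^+ j.+1.
Proof.
move=> a0 th0; apply: contrapT => /forallNP no.
suff f0 j : factor a j != 0.
  have := infprod_neq0 (bound_ge0 a) modulus_nome (factor_bound a) f0 (@theta_cvg a).
  by rewrite th0 eqxx.
apply: contra_notN (no j); rewrite mulf_eq0 !subr_eq0 => /orP[] /eqP h; [left|right] => //.
by rewrite -[a]mul1r h divfK.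
Qed.

Lemma theta1 : theta p 1 = 0.
Proof.
apply: (cvg_unique _ (@theta_cvg 1)) => //.
apply: (@modulus_squeeze _ _ _ (fun m => (m == 0%N)%:R)) => [m|].
  case: m => [|m]; first by rewrite /theta_trunc big_ord0 subr0 modulus1.
  by rewrite /theta_trunc big_ord_recl /factor expr0 mulr1 subrr !mul0r subr0 modulus0.
by apply/cvgrPdist_lt => e e0; exists 1%N => // -[|m] //= _; rewrite subrr normr0.
Qed.

Lemma nomeX_cvg0 a : (fun m => a * p ^+ m) @ \oo --> (0 : C).
Proof.
apply: (modulus_squeeze _ (geometric_cvg0 (modulus a) modulus_nome)) => m.
by rewrite subr0 modulusM modulusX.
Qed.

(** Both truncated products have the same factors up to the first and the last
    one; the limit of the exact relation between them is the inversion formula. *)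
Lemma theta_inv a : a != 0 -> theta p a^-1 = - a^-1 * theta p a.
Proof.
move=> a0; have [->|a1] := eqVneq a 1; first by rewrite invr1 theta1 mulr0.
have fin m : theta_trunc a^-1 m * ((1 - a) * (1 - a^-1 * p ^+ m)) =
    theta_trunc a m * ((1 - a^-1) * (1 - a * p ^+ m)).
  elim: m => [|m IH]; first by rewrite /theta_trunc !big_ord0 !expr0 !mulr1 !mul1r mulrC.
  rewrite /theta_trunc !big_ord_recr /= -!/(theta_trunc _ _).
  transitivity (theta_trunc a^-1 m * ((1 - a) * (1 - a^-1 * p ^+ m)) *
    ((1 - p ^+ m.+1 * a) * (1 - a^-1 * p ^+ m.+1))).
    by rewrite /factor invrK; ring.
  by rewrite IH /factor; ring.
have lim1 : (fun m => theta_trunc a^-1 m * ((1 - a) * (1 - a^-1 * p ^+ m))) @ \oo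
    --> theta p a^-1 * ((1 - a) * (1 - 0)).
  apply: cvgM; first exact: theta_cvg.
  apply: cvgM; first exact: cvg_cst.
  by apply: cvgB; [exact: cvg_cst|exact: nomeX_cvg0].
have lim2 : (fun m => theta_trunc a m * ((1 - a^-1) * (1 - a * p ^+ m))) @ \oo
    --> theta p a * ((1 - a^-1) * (1 - 0)).
  apply: cvgM; first exact: theta_cvg.
  apply: cvgM; first exact: cvg_cst.
  by apply: cvgB; [exact: cvg_cst|exact: nomeX_cvg0].
rewrite (_ : (fun m => _) = (fun m => theta_trunc a m * ((1 - a^-1) * (1 - a * p ^+ m))))
  in lim1; last exact/funext.
have := cvg_unique _ lim1 lim2; rewrite subr0 !mulr1 => /(_ (@norm_hausdorff _ _)) E.
have a1' : 1 - a != 0 by rewrite subr_eq0 eq_sym.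
apply: (mulIf a1'); rewrite E; by field.
Qed.

(** A sequence of distinct points of a fundamental domain for multiplication by
    the modulus of p. *)
Definition annulus_pt (m : nat) : R := r + (1 - r) / m.+1%:R.

Lemma annulus_ptP m : r < annulus_pt m <= 1.
Proof.
have /andP[r0 r1] := modulus_nome.
have m0 : 0 < m.+1%:R :> R by rewrite ltr0n.
rewrite /annulus_pt ltrDl divr_gt0 ?subr_gt0 //= -lerBrDl ler_pdivrMr //.
by rewrite ler_peMr ?subr_ge0 ?(ltW r1) // ler1n.
Qed.

Lemma annulus_pt_inj : injective annulus_pt.
Proof.
have /andP[r0 r1] := modulus_nome.
move=> m m' /addrI /mulfI; rewrite subr_eq0 gt_eqF // => /(_ isT) /invr_inj /eqP.
by rewrite eqr_nat => /eqP[].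
Qed.

Definition annulus_ptC m : C := (annulus_pt m)%:C.

Lemma modulus_annulus m : modulus (annulus_ptC m) = annulus_pt m.
Proof.
rewrite /annulus_ptC /modulus /= expr0n /= addr0 sqrtr_sqr ger0_norm //.
have /andP[r0 r1] := modulus_nome.
by have /andP[/ltW h _] := annulus_ptP m; apply: le_trans h.
Qed.

Lemma annulus_neq0 m : annulus_ptC m != 0.
Proof.
rewrite -modulus_gt0 modulus_annulus; have /andP[r0 r1] := modulus_nome.
by have /andP[h _] := annulus_ptP m; apply: le_lt_trans h.
Qed.

Lemma annulus_zero_inj t m m' : t != 0 ->
  theta p (annulus_ptC m * t) = 0 -> theta p (annulus_ptC m' * t) = 0 -> m = m'.
Proof.
move=> t0 h h'; apply: annulus_pt_inj.
have /andP[r0 r1] := modulus_nome.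
have /andP[a1 a2] := annulus_ptP m; have /andP[b1 b2] := annulus_ptP m'.
have [j hj] := theta_zero (mulf_neq0 (annulus_neq0 m) t0) h.
have [i hi] := theta_zero (mulf_neq0 (annulus_neq0 m') t0) h'.
have T0 : 0 < modulus t by rewrite modulus_gt0.
have {}hj : annulus_pt m * modulus t * r ^+ j = 1 \/ annulus_pt m * modulus t = r ^+ j.+1.
  by rewrite -modulus_annulus -modulusM -!modulusX -modulusM -modulus1; case: hj => ->; auto.
have {}hi : annulus_pt m' * modulus t * r ^+ i = 1 \/ annulus_pt m' * modulus t = r ^+ i.+1.
  by rewrite -modulus_annulus -modulusM -!modulusX -modulusM -modulus1; case: hi => ->; auto.
suff : annulus_pt m * modulus t = annulus_pt m' * modulus t.
  by apply: mulIf; rewrite gt_eqF.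
exact: (@annulus_zero_uniq _ r _ _ _ i j).
Qed.

(** Each t excludes at most one point of the annulus, because the zeros of theta
    are powers of p; so among more than [size s] points one avoids all zeros. *)
Lemma theta_generic (s : seq C) : (forall t, t \in s -> t != 0) ->
  exists2 d : C, d != 0 & forall t, t \in s -> theta p (d * t) != 0.
Proof.
move=> s0; apply: contrapT => no.
have bad m : exists i : 'I_(size s), theta p (annulus_ptC m * s`_i) == 0.
  apply: contrapT => /forallNP h; apply: no; exists (annulus_ptC m).
    exact: annulus_neq0.
  move=> t /(nthP 0)[i si <-]; apply/negP => z.
  exact: (h (Ordinal si)).
have {bad}/choice[g hg] := bad.
have inj : injective (fun m : 'I_(size s).+1 => g m).
  move=> m m' e; apply: val_inj; apply: (@annulus_zero_inj s`_(g m)).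
  - by rewrite s0 // mem_nth.
  - exact/eqP/hg.
  - by rewrite e; apply/eqP/hg.
by have := leq_card _ inj; rewrite !card_ord ltnn.
Qed.

End ThetaFunction.

(** * Bilateral series with geometric decay *)

Lemma big_subset_split (V : nmodType) (I : eqType) (s t : seq I) (F : I -> V) :
  uniq s -> uniq t -> {subset s <= t} ->
  \sum_(i <- t) F i = \sum_(i <- s) F i + \sum_(i <- t | i \notin s) F i.
Proof.
move=> us ut st; rewrite (bigID (mem s)) /=; congr (_ + _).
rewrite -big_filter; apply: perm_big; apply: uniq_perm; rewrite ?filter_uniq //.
by move=> i; rewrite mem_filter; apply: andb_idr; exact: st.
Qed.

Section Bilateral.
Variable R : realType.
Local Notation C := (Cx R).

Definition int_ball (m : nat) : seq int := [seq i%:Z - m%:Z | i <- iota 0 m.*2.+1].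

Lemma mem_int_ball m k : (k \in int_ball m) = (absz k <= m)%N.
Proof.
apply/mapP/idP => [[i +]|km]; first by rewrite mem_iota => ? ->; lia.
by exists (absz (k + m%:Z)); [rewrite mem_iota; lia|lia].
Qed.

Lemma uniq_int_ball m : uniq (int_ball m).
Proof. by rewrite map_inj_uniq ?iota_uniq // => i j; lia. Qed.

Lemma big_int_ball (V : nmodType) (F : int -> V) m :
  \sum_(k <- int_ball m) F k = \sum_(i < m.*2.+1) F (i%:Z - m%:Z).
Proof. by rewrite big_map -(big_mkord xpredT (fun i => F (i%:Z - m%:Z))) /index_iota subn0. Qed.

#[global] Opaque int_ball.

Lemma big_int_ball_recr (V : nmodType) (F : int -> V) m :
  \sum_(k <- int_ball m.+1) F k = \sum_(k <- int_ball m) F k + (F m.+1%:Z + F (- m.+1%:Z)).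
Proof.
have -> : F m.+1%:Z + F (- m.+1%:Z) = \sum_(k <- [:: m.+1%:Z; - m.+1%:Z]) F k.
  by rewrite !big_cons big_nil addr0.
rewrite -big_cat; apply: perm_big; apply: uniq_perm; first exact: uniq_int_ball.
  by rewrite cat_uniq uniq_int_ball /= !mem_int_ball; lia.
by move=> k; rewrite mem_cat !mem_int_ball !inE; lia.
Qed.

Definition decays (r : R) (F : int -> C) : Prop :=
  exists2 D, 0 <= D & forall k, modulus (F k) <= D * r ^+ `|k|%N.

(** The ratio of consecutive terms tends to 0 geometrically, hence h_n / r^n is
    dominated by a convergent infinite product. *)
Lemma decay_nat (h : nat -> R) (y r : R) : 0 < r < 1 -> 0 <= y ->
  (forall n, 0 <= h n) -> (forall n, h n.+1 <= y * r ^+ n * h n) ->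
  exists2 D, 0 <= D & forall n, h n <= D * r ^+ n.
Proof.
move=> /andP[r0 r1] y0 h0 hn.
have u_bound i : 0 <= y / r * r ^+ i <= y / r * r ^+ i.
  by rewrite lexx andbT mulr_ge0 ?exprn_ge0 ?divr_ge0 // ltW.
have [||B B0 hB] := prod1D_bounded _ _ u_bound; first by rewrite divr_ge0 // ltW.
  by rewrite ltW.
exists (h 0%N * B) => [|n]; first by rewrite mulr_ge0.
have le1 : h n <= h 0%N * r ^+ n * \prod_(i < n) (1 + y / r * r ^+ i).
  elim: n => [|n IH]; first by rewrite big_ord0 expr0 !mulr1.
  apply: le_trans (hn n) _.
  have yr0 : 0 <= y * r ^+ n by rewrite mulr_ge0 // exprn_ge0 // ltW.
  apply: le_trans (ler_wpM2l yr0 IH) _.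
  rewrite big_ord_recr /= exprS.
  set Q := \prod_(i < n) _.
  have Q0 : 0 <= Q by apply: prodr_ge0 => i _; rewrite addr_ge0 //; case/andP: (u_bound i).
  have -> : h 0%N * (r * r ^+ n) * (Q * (1 + y / r * r ^+ n)) =
     y * r ^+ n * (h 0%N * r ^+ n * Q) + h 0%N * (r * r ^+ n) * Q.
    by field; rewrite gt_eqF.
  by rewrite lerDl !mulr_ge0 // ?exprn_ge0 // ltW.
apply: le_trans le1 _; rewrite mulrAC.
have rn : 0 <= r ^+ n by rewrite exprn_ge0 ?ltW.
by apply: ler_wpM2r => //; apply: ler_wpM2l.
Qed.

Lemma decays_ratio (r y : R) (F : int -> C) : 0 < r < 1 -> 0 <= y ->
  (forall n : nat, modulus (F n.+1%:Z) <= y * r ^+ n * modulus (F n%:Z)) ->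
  (forall n : nat, modulus (F (- n.+1%:Z)) <= y * r ^+ n * modulus (F (- n%:Z))) ->
  decays r F.
Proof.
move=> r01 y0 hp hm; case/andP: (r01) => r0 _.
have [n|D D0 hD] := decay_nat r01 y0 _ hp; first exact: modulus_ge0.
have [n|E E0 hE] := decay_nat r01 y0 _ hm; first exact: modulus_ge0.
exists (D + E) => [|k]; first by rewrite addr_ge0.
have rX n : 0 <= r ^+ n by rewrite exprn_ge0 // ltW.
have [n [->|->]] : exists n : nat, k = n%:Z \/ k = - n%:Z.
  by exists `|k|%N; lia.
  by rewrite /= (le_trans (hD n)) // ler_wpM2r // lerDl.
by rewrite abszN /= (le_trans (hE n)) // ler_wpM2r // lerDr.
Qed.

Section Decaying.
Variables (r : R) (r01 : 0 <= r < 1).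

Let rX n : 0 <= r ^+ n. Proof. by rewrite exprn_ge0 //; case/andP: r01. Qed.

Lemma rXS_le n : r ^+ n.+1 <= r ^+ n.
Proof. by rewrite exprS ler_piMl //; case/andP: r01 => _ /ltW. Qed.

Lemma bisum_cvg F : decays r F ->
  exists l : C, (fun m => \sum_(k <- int_ball m) F k) @ \oo --> l.
Proof.
move=> [D D0 hD]; apply: (@cvgC_geometric _ _ (D + D) r) => // m.
rewrite big_int_ball_recr addrAC subrr add0r (le_trans (modulusD _ _)) // mulrDl.
apply: lerD; apply: le_trans (hD _) _; rewrite ler_wpM2l //.
  exact: rXS_le.
by rewrite abszN; exact: rXS_le.
Qed.

Lemma bisumR_cvg (h : int -> R) D : (forall k, 0 <= h k <= D * r ^+ `|k|%N) -> 0 <= D ->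
  exists l : R, (fun m => \sum_(k <- int_ball m) h k) @ \oo --> l.
Proof.
move=> hD D0; apply: (@cvgR_geometric _ _ (D + D) r) => // m.
rewrite big_int_ball_recr addrAC subrr add0r mulrDl.
have h1 := hD m.+1%:Z; have h2 := hD (- m.+1%:Z).
case/andP: h1 => a1 b1; case/andP: h2 => a2 b2.
rewrite ger0_norm ?addr_ge0 //; apply: lerD.
  by rewrite (le_trans b1) // ler_wpM2l // rXS_le.
by rewrite (le_trans b2) // ler_wpM2l // abszN rXS_le.
Qed.

(** Tannery's theorem: the terms outside a large ball are controlled by the
    geometric majorant, and only finitely many remain. *)
Lemma bisum_tannery (G : nat -> int -> C) D : 0 <= D ->
  (forall m k, (absz k <= m)%N -> modulus (G m k) <= D * r ^+ `|k|%N) ->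
  (forall k, (fun m => G m k) @ \oo --> (0 : C)) ->
  (fun m => \sum_(k <- int_ball m) G m k) @ \oo --> (0 : C).
Proof.
move=> D0 GD G0.
pose H m := \sum_(k <- int_ball m) D * r ^+ `|k|%N.
have [k|//|L HL] := @bisumR_cvg (fun k => D * r ^+ `|k|%N) D.
  by rewrite lexx andbT mulr_ge0.
apply: (@modulus_squeeze _ _ _ (fun m => modulus (\sum_(k <- int_ball m) G m k))) => [m|].
  by rewrite subr0.
apply/cvgrPdist_le => e e0; rewrite -/H in HL.
(* H M and H m will both be within e / 4 of their limit, so the terms outside
   the ball of radius M contribute at most e / 2. *)
have e4 : 0 < e / 4 by rewrite divr_gt0.
move/cvgrPdist_le: HL => /(_ _ e4)[M _ hM].
have fin : (fun m => \sum_(k <- int_ball M) modulus (G m k)) @ \oo --> (0 : R).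
  elim: (int_ball M) => [|k s IH].
    rewrite (_ : (fun _ => _) = fun=> 0); first exact: cvg_cst.
    by apply/funext => m; rewrite big_nil.
  rewrite (_ : (fun _ => _) =
      (fun m => modulus (G m k) + \sum_(j <- s) modulus (G m j))); last first.
    by apply/funext => m; rewrite big_cons.
  rewrite -[X in _ --> X]addr0; apply: cvgD => //.
  have := modulus_cvg0 (G0 k); rewrite (_ : (fun _ => _) = fun m => modulus (G m k)) //.
  by apply/funext => m; rewrite subr0.
have e2 : 0 < e / 2 by rewrite divr_gt0.
move/cvgrPdist_le: fin => /(_ _ e2)[K _ hK].
exists (maxn M K) => // m /=; rewrite geq_max => /andP[Mm Km].
rewrite sub0r normrN ger0_norm ?modulus_ge0 //.
have sub : {subset int_ball M <= int_ball m} by move=> k; rewrite !mem_int_ball => /leq_trans; apply.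
apply: le_trans (modulus_sum _ _ _) _.
rewrite (big_subset_split _ (uniq_int_ball M) (uniq_int_ball m) sub).
have := hK m Km; rewrite /= sub0r normrN ger0_norm; last first.
  by apply: sumr_ge0 => k _; exact: modulus_ge0.
have : \sum_(k <- int_ball m | k \notin int_ball M) modulus (G m k) <= H m - H M.
  rewrite /H (big_subset_split _ (uniq_int_ball M) (uniq_int_ball m) sub) addrAC subrr add0r.
  rewrite big_seq_cond [leRHS]big_seq_cond; apply: ler_sum => k /andP[km _].
  by apply: GD; rewrite -mem_int_ball.
have := hM M (leqnn M); have := hM m Mm; rewrite /= !ler_norml.
move=> /andP[a1 a2] /andP[b1 b2]; lra.
Qed.

End Decaying.
End Bilateral.

(** * The q-binomial theorem *)

Section GaussBinomial.
Variables (F : fieldType) (p : F).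
Implicit Types (z : F).

(** The exponent k(k-1)/2 for k of either sign. *)
Definition tri (k : int) : int := ((k * (k - 1)) %/ 2)%Z.

Lemma triE k : tri k * 2 = k * (k - 1).
Proof.
rewrite /tri divzK //.
have [m [->|->]] : exists m, k = m * 2 \/ k = m * 2 + 1.
  by exists (k %/ 2)%Z; lia.
  by rewrite mulrAC dvdz_mull.
by rewrite addrK mulrA dvdz_mull.
Qed.

Lemma triD1 k : tri (k + 1) = tri k + k.
Proof. by have := triE (k + 1); have := triE k; lia. Qed.

(** In the coordinates s, t the quadratic exponent of a product of two theta
    series separates; this is the reason for [theta_rank2]. *)
Lemma triDB s t : tri (s + t) + tri (s - t) = s * (s - 1) + t * t.
Proof. by have := triE (s + t); have := triE (s - t); lia. Qed.

Lemma triDB1 s t : tri (s + t) + tri (s - t + 1) = s * s + t * (t - 1).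
Proof. by have := triE (s + t); have := triE (s - t + 1); lia. Qed.

Definition qfact n : F := \prod_(i < n) (1 - p ^+ i.+1).

Fixpoint qbin n k : F :=
  match n, k with
  | _, 0%N => 1
  | 0%N, _.+1 => 0
  | n'.+1, k'.+1 => qbin n' k + p ^+ (n' - k') * qbin n' k'
  end.

Lemma qbin0r n : qbin n 0 = 1. Proof. by case: n. Qed.

Lemma qbin_small n k : (n < k)%N -> qbin n k = 0.
Proof.
elim: n k => [|n IH] [|k] //= lt; rewrite !IH ?mulr0 ?addr0 //; lia.
Qed.

Lemma qbin_fact n k : (k <= n)%N -> qbin n k * (qfact k * qfact (n - k)) = qfact n.
Proof.
have qfS m : qfact m.+1 = qfact m * (1 - p ^+ m.+1) by rewrite /qfact big_ord_recr.
have qf0 : qfact 0 = 1 by rewrite /qfact big_ord0.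
elim: n k => [|n IH] [|k] //= kn; rewrite ?qf0 ?mul1r ?subn0 ?mulr1 //.
rewrite subSS ltnS in kn *; rewrite mulrDl.
have e2 : p ^+ (n - k) * qbin n k * (qfact k.+1 * qfact (n - k)) =
    p ^+ (n - k) * (1 - p ^+ k.+1) * qfact n.
  by rewrite -(IH k kn) qfS; ring.
rewrite e2 [qfact n.+1]qfS; move: kn; rewrite leq_eqVlt => /orP[/eqP ->|kn].
  by rewrite qbin_small // subnn expr0; ring.
have e1 : qbin n k.+1 * (qfact k.+1 * qfact (n - k)) = (1 - p ^+ (n - k)) * qfact n.
  by rewrite -(IH k.+1 kn) (_ : (n - k = (n - k.+1).+1)%N) ?qfS; [ring|lia].
rewrite e1 (_ : n.+1 = (n - k) + k.+1)%N; last by lia.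
by rewrite exprD; ring.
Qed.

Lemma qbinomial n z : p != 0 ->
  \prod_(j < n) (1 - z * p ^+ j) =
  \sum_(k < n.+1) (-1) ^ k%:Z * p ^ tri k * qbin n k * z ^+ k.
Proof.
move=> p0; elim: n => [|n IH].
  by rewrite !big_ord_recl !big_ord0 /= /tri mul0r div0z !expr0z expr0 !mulr1 addr0.
rewrite big_ord_recr /= IH mulrBr mulr1.
have E : \sum_(k < n.+1) (-1) ^ k%:Z * p ^ tri k * qbin n k * z ^+ k =
    \sum_(k < n.+2) (-1) ^ k%:Z * p ^ tri k * qbin n k * z ^+ k.
  by rewrite [RHS]big_ord_recr /= qbin_small // mulr0 mul0r addr0.
rewrite {1}E big_ord_recl [in RHS]big_ord_recl /= !qbin0r -addrA; congr (_ + _).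
rewrite mulr_suml -sumrB; apply: eq_bigr => k _ /=.
have kn : (k <= n)%N by rewrite -ltnS.
rewrite /bump /= add1n -addn1 PoszD triD1 !expfzDr ?oppr_eq0 ?oner_eq0 //.
rewrite add0n (_ : p ^+ n = p ^+ (n - k) * p ^+ k); last by rewrite -exprD subnK.
by rewrite exprD -!exprnP !expr1; ring.
Qed.
End GaussBinomial.

(** * The Jacobi triple product *)

Lemma cvg_bounded (R : realType) (u : nat -> Cx R) (l : Cx R) :
  u @ \oo --> l -> exists2 B, 0 <= B & forall n, modulus (u n) <= B.
Proof.
move=> /modulus_cvg0/cvgrPdist_lt/(_ _ ltr01)[M _ hM].
have S0 : 0 <= \sum_(i < M) modulus (u i) by apply: sumr_ge0 => i _; exact: modulus_ge0.
exists (\sum_(i < M) modulus (u i) + (modulus l + 1)) => [|n].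
  by rewrite !addr_ge0 // modulus_ge0.
have [nM|Mn] := ltnP n M.
  rewrite (bigD1 (Ordinal nM)) //= -addrA lerDl addr_ge0 //.
    by apply: sumr_ge0 => i _; exact: modulus_ge0.
  by rewrite addr_ge0 // modulus_ge0.
have := hM n Mn; rewrite /= sub0r normrN ger0_norm ?modulus_ge0 // => h.
have := modulusD (u n - l) l; rewrite subrK => h'.
by rewrite (le_trans h') // addrC ler_wpDl // lerD2l ltW.
Qed.

Section JacobiTripleProduct.
Variable R : realType.
Local Notation C := (Cx R).
Variable p : C.
Hypotheses (hp : `|p| < 1) (p0 : p != 0).
Local Notation r := (modulus p).
Implicit Types (a X Y z : C).

Let r01 : 0 < r < 1.
Proof. by rewrite modulus_gt0 p0; have /andP[_ ->] := modulus_nome hp. Qed.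

Let r01' : 0 <= r < 1. Proof. exact: modulus_nome. Qed.

Let rX n : 0 <= r ^+ n. Proof. by rewrite exprn_ge0 // modulus_ge0. Qed.

Definition theta_term a (k : int) : C := (-1) ^ k * p ^ tri k * a ^ k.

Lemma theta_termS a k : a != 0 -> theta_term a (k + 1) = - (p ^ k * a) * theta_term a k.
Proof.
move=> a0; rewrite /theta_term triD1 !expfzDr ?oppr_eq0 ?oner_eq0 // !expr1z; ring.
Qed.

Lemma theta_term_decays a : a != 0 -> decays r (theta_term a).
Proof.
move=> a0; have A0 : modulus a != 0 by rewrite modulus_eq0.
apply: (@decays_ratio _ r (modulus a + (modulus a)^-1)) => // [|n|n].
- by rewrite addr_ge0 ?invr_ge0 // modulus_ge0.
- rewrite -addn1 PoszD theta_termS // modulusM modulusN modulusM -exprnP modulusX.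
  rewrite ler_wpM2r ?modulus_ge0 // mulrDl mulrC lerDl.
  by rewrite mulr_ge0 // invr_ge0 modulus_ge0.
- have := theta_termS (- n.+1%:Z) a0; rewrite (_ : - n.+1%:Z + 1 = - n%:Z); last by lia.
  move=> ->; move: (theta_term a _) => J.
  rewrite modulusM modulusN modulusM -exprnN modulusV modulusX mulrA.
  have r0 : r != 0 by rewrite gt_eqF //; case/andP: r01.
  rewrite ler_peMl ?modulus_ge0 //.
  have -> : (modulus a + (modulus a)^-1) * r ^+ n * (r ^- n.+1 * modulus a) =
      (modulus a * modulus a + 1) / r.
    by rewrite exprS; field; rewrite A0 r0 expf_neq0.
  case/andP: r01 => r0' /ltW r1; rewrite ler_pdivlMr // mul1r.
  by rewrite (le_trans r1) // lerDr mulr_ge0 // modulus_ge0.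
Qed.

(** Only the growth of the increments of the exponent Q matters, so that the
    same bound serves t^2 and t(t-1). *)
Lemma quad_decays (Q : int -> int) (z : C) : z != 0 ->
  (forall n : nat, exists2 i : nat, Q n.+1%:Z = Q n%:Z + i%:Z & (n <= i)%N) ->
  (forall n : nat, exists2 i : nat, Q (- n.+1%:Z) = Q (- n%:Z) + i%:Z & (n <= i)%N) ->
  decays r (fun t => p ^ Q t * z ^ t).
Proof.
move=> z0 Qp Qm.
have rle n i : (n <= i)%N -> r ^+ i <= r ^+ n.
  by case/andP: r01 => ? ? ni; apply: ler_wiXn2l => //; apply: ltW.
apply: (@decays_ratio _ r (modulus z + modulus z^-1)) => // [|n|n].
- by rewrite addr_ge0 // modulus_ge0.
- have [i -> /rle ri] := Qp n; rewrite -addn1 PoszD !expfzDr // expr1z -exprnP.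
  set T := modulus (p ^ Q n * _).
  have -> : modulus (p ^ Q n * p ^+ i * (z ^ n%:Z * z)) = modulus z * r ^+ i * T.
    by rewrite /T !modulusM modulusX; ring.
  rewrite ler_wpM2r ?modulus_ge0 // mulrDl.
  rewrite (@le_trans _ _ (modulus z * r ^+ n)) ?ler_wpM2l ?modulus_ge0 //.
  by rewrite lerDl mulr_ge0 // modulus_ge0.
- have [i -> /rle ri] := Qm n.
  rewrite (_ : - n.+1%:Z = - n%:Z + (- 1)); last by lia.
  rewrite !expfzDr // exprN1 -exprnP.
  set T := modulus (p ^ Q _ * _).
  have -> : modulus (p ^ Q (- n%:Z) * p ^+ i * (z ^ (- n%:Z) / z)) = modulus z^-1 * r ^+ i * T.
    by rewrite /T !modulusM modulusX; ring.
  rewrite ler_wpM2r ?modulus_ge0 // mulrDl.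
  rewrite (@le_trans _ _ (modulus z^-1 * r ^+ n)) ?ler_wpM2l ?modulus_ge0 //.
  by rewrite lerDr mulr_ge0 // modulus_ge0.
Qed.

Lemma sq_decays z : z != 0 -> decays r (fun t => p ^ (t * t) * z ^ t).
Proof.
by move=> z0; apply: (@quad_decays (fun t => t * t)) => // n; exists (n.*2.+1); lia.
Qed.

Lemma sq1_decays z : z != 0 -> decays r (fun t => p ^ (t * (t - 1)) * z ^ t).
Proof.
move=> z0; apply: (@quad_decays (fun t => t * (t - 1))) => // n.
  by exists (n.*2); lia.
by exists (n.*2.+2); lia.
Qed.

Lemma qfact_neq0 n : qfact p n != 0.
Proof.
apply/prodf_neq0 => i _; rewrite subr_eq0 eq_sym; apply/eqP => E.
have := modulusX p i.+1; rewrite E modulus1 exprS => h.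
have /andP[_ r1] := r01'; have := nome_exp_le1 hp i => h'.
have : r * r ^+ i <= r by rewrite ler_piMr // modulus_ge0.
by rewrite -h leNgt r1.
Qed.

Lemma qfact_cvg : exists2 l : C, l != 0 & (fun n => qfact p n) @ \oo --> l.
Proof.
have bd j : modulus (1 - p ^+ j.+1 - 1) <= 1 * r ^+ j.
  rewrite addrAC subrr add0r modulusN modulusX mul1r.
  exact: rXS_le r01' j.
have [l hl] := infprod_cvg ler01 r01' bd.
exists l => //; apply: (infprod_neq0 ler01 r01' bd _ hl) => j.
rewrite subr_eq0 eq_sym; apply/eqP => E.
have := qfact_neq0 j.+1; rewrite /qfact big_ord_recr /= E subrr mulr0 eqxx.
by [].
Qed.

Definition triple_coef m (k : int) : C :=
  qfact p m.*2 / (qfact p (absz (m%:Z + k)%R) * qfact p (absz (m%:Z - k)%R)).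

(** The q-binomial theorem with 2 m factors at a p^(-m): extracting the powers
    of p from the first m factors centres the sum at k = 0. *)
Lemma finite_triple_product a m : a != 0 ->
  theta_trunc p a m = \sum_(k <- int_ball m) triple_coef m k * theta_term a k.
Proof.
move=> a0; pose z := a * p ^- m.
(* kap collects what the factors 1 - a p^-(j+1) leave when rewritten as
   multiples of 1 - p^(j+1) / a. *)
pose kap : C := \prod_(j < m) (- (a * p ^- j.+1)).
have kap0 : kap * theta_term a (- m%:Z) = 1.
  rewrite /kap; elim: m {z kap} => [|m IH].
    by rewrite big_ord0 /theta_term /tri oppr0 mul0r div0z !expr0z !mulr1.
  rewrite big_ord_recr /= -[RHS]IH -mulrA; congr (_ * _).
  rewrite (_ : - m%:Z = - m.+1%:Z + 1); last by lia.
  by rewrite theta_termS // -exprnN; ring.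
have kapE i : kap * theta_term a (i%:Z - m%:Z) = (-1) ^ i%:Z * p ^ tri i * z ^+ i.
  elim: i => [|i IH].
    by rewrite sub0r kap0 /tri mul0r div0z !expr0z expr0 !mulr1.
  rewrite (_ : i.+1%:Z - m%:Z = i%:Z - m%:Z + 1); last by lia.
  rewrite theta_termS // mulrCA IH -addn1 PoszD triD1 !expfzDr ?oppr_eq0 ?oner_eq0 //.
  by rewrite -exprnN /z exprD -!exprnP !expr1; ring.
have kap_neq0 : kap != 0.
  by apply/eqP => E; move: kap0; rewrite E mul0r => /esym/eqP; rewrite oner_eq0.
apply: (mulfI kap_neq0); transitivity (\prod_(j < m.*2) (1 - z * p ^+ j)).
  have Q1 : \prod_(j < m) (1 - z * p ^+ j) = kap * \prod_(j < m) (1 - p ^+ j.+1 / a).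
    rewrite (reindex_inj rev_ord_inj) /= /kap -big_split /=; apply: eq_bigr => j _.
    rewrite /z; have -> : p ^- m = p ^- j.+1 / p ^+ (m - j.+1).
      by rewrite -invfM -exprD subnKC.
    by field; rewrite !expf_neq0 // a0.
  have Q2 : \prod_(j < m) (1 - z * p ^+ (m + j)) = \prod_(j < m) (1 - a * p ^+ j).
    apply: eq_bigr => j _; rewrite exprD /z; field.
    by rewrite expf_neq0.
  by rewrite -addnn big_split_ord /= Q1 Q2 theta_truncE; ring.
rewrite qbinomial // mulr_sumr big_int_ball; apply: eq_bigr => i _.
have J : triple_coef m (i%:Z - m%:Z) = qbin p m.*2 i.
  rewrite /triple_coef -(@qbin_fact _ p m.*2 i); last by rewrite -ltnS.
  have -> : absz (m%:Z + (i%:Z - m%:Z))%R = i by lia.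
  have -> : absz (m%:Z - (i%:Z - m%:Z))%R = (m.*2 - i)%N by have := ltn_ord i; lia.
  by rewrite mulfK // mulf_neq0 // qfact_neq0.
by rewrite mulrCA kapE J; ring.
Qed.

(** The indices m + k and m - k of a triple-product coefficient tend to
    infinity with m. *)
Lemma cvg_absz (k : int) (u : nat -> C) (l : C) (f : nat -> int) :
  (forall m, absz (f m) + absz k >= m)%N ->
  u @ \oo --> l -> (fun m => u `|f m|%N) @ \oo --> l.
Proof.
move=> fk /cvgrPdist_lt ul; apply/cvgrPdist_lt => e e0.
have [M _ hM] := ul _ e0; exists (M + `|k|)%N => // m /= Mm.
by apply: hM => /=; have := fk m; lia.
Qed.

(** Limit of [finite_triple_product] by Tannery's theorem: every coefficient
    tends to the inverse of P, the infinite product of the 1 - p^i. *)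
Lemma triple_product a (P : C) : a != 0 -> P != 0 -> (fun n => qfact p n) @ \oo --> P ->
  (fun m => \sum_(k <- int_ball m) theta_term a k) @ \oo --> P * theta p a.
Proof.
move=> a0 P0 hP.
have Pk k : (fun m => qfact p (absz (m%:Z + k)%R)) @ \oo --> P.
  by apply: (@cvg_absz k (qfact p) P (fun m : nat => (m%:Z + k)%R)) => // m; lia.
have P2 : (fun m => qfact p m.*2) @ \oo --> P.
  by apply: (@cvg_absz 0 (qfact p) P (fun m : nat => m.*2%:Z)) => // m; lia.
have triple_coef_cvg k : (fun m => triple_coef m k) @ \oo --> P^-1.
  have -> : P^-1 = P / (P * P) by field.
  rewrite /triple_coef; apply: cvgM; first exact: P2.
  apply: cvgV; first by rewrite mulf_neq0.
  apply: cvgM; first exact: Pk.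
  exact: (Pk (- k)).
have [B B0 hB] := cvg_bounded hP.
have [B' B'0 hB'] := cvg_bounded (cvgV P0 hP).
have [D D0 hD] := theta_term_decays a0.
have lim0 : (fun m => \sum_(k <- int_ball m) (triple_coef m k - P^-1) * theta_term a k) @ \oo --> (0 : C).
  pose E := B * (B' * B') + modulus P^-1.
  have E0 : 0 <= E by rewrite addr_ge0 ?mulr_ge0 ?modulus_ge0.
  apply: (bisum_tannery r01' (D := E * D)) => [|m k km|k]; first exact: mulr_ge0.
    rewrite modulusM -mulrA ler_pM ?modulus_ge0 // (le_trans (modulusB _ _)) //.
    rewrite lerD2r /triple_coef invfM !modulusM.
    rewrite ler_pM ?modulus_ge0 ?mulr_ge0 ?modulus_ge0 ?hB //.
    by rewrite ler_pM ?modulus_ge0 ?hB'.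
  rewrite -(mul0r (theta_term a k)); apply: cvgM; last exact: cvg_cst.
  rewrite -(subrr P^-1); apply: cvgB; [exact: triple_coef_cvg|exact: cvg_cst].
have -> : P * theta p a = P * (theta p a - 0) by rewrite subr0.
rewrite (_ : (fun m => _) = (fun m => P * (theta_trunc p a m -
    \sum_(k <- int_ball m) (triple_coef m k - P^-1) * theta_term a k))); last first.
  apply/funext => m; rewrite finite_triple_product // -sumrB mulr_sumr.
  by apply: eq_bigr => k _; field.
apply: cvgM; first exact: cvg_cst.
apply: cvgB; [exact: theta_cvg|exact: lim0].
Qed.

End JacobiTripleProduct.

(** * Products of two theta functions *)

Section RankTwo.
Variable R : realType.
Local Notation C := (Cx R).
Variable p : C.
Hypotheses (hp : `|p| < 1) (p0 : p != 0).
Local Notation r := (modulus p).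
Implicit Types (X Y z : C).

Definition square m : seq (int * int) := [seq (k, l) | k <- int_ball m, l <- int_ball m].

(** The coordinates (s, t) with k + l = 2s or 2s + 1: a second exhaustion of the
    lattice of pairs (k, l), adapted to the separation of the exponents. *)
Definition diamond m : seq (int * int) :=
  [seq (s + t, s - t) | s <- int_ball m, t <- int_ball m] ++
  [seq (s + t, s - t + 1) | s <- int_ball m, t <- int_ball m].

Lemma mem_square m k l : ((k, l) \in square m) = (absz k <= m)%N && (absz l <= m)%N.
Proof.
rewrite -!mem_int_ball; apply/allpairsP/idP => [[[a b] [ha hb [-> ->]]]|/andP[ha hb]].
  by apply/andP.
by exists (k, l).
Qed.

Lemma uniq_square m : uniq (square m).
Proof. by apply: allpairs_uniq; rewrite ?uniq_int_ball // => -[a b] [c d] _ _ [-> ->]. Qed.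

Lemma mem_diamond m k l : reflect
  (exists s t, [/\ (absz s <= m)%N, (absz t <= m)%N &
     (k = s + t /\ l = s - t) \/ (k = s + t /\ l = s - t + 1)])
  ((k, l) \in diamond m).
Proof.
rewrite mem_cat; apply: (iffP orP).
  case=> /allpairsP[[a b] /= [ha hb [-> ->]]]; exists a, b; rewrite -!mem_int_ball; split; auto.
case=> s [t [hs ht [] [-> ->]]]; [left|right]; apply/allpairsP; exists (s, t);
  by rewrite /= !mem_int_ball.
Qed.

Lemma uniq_diamond m : uniq (diamond m).
Proof.
rewrite cat_uniq; apply/and3P; split.
- apply: allpairs_uniq; rewrite ?uniq_int_ball // => -[a b] [c d] _ _ /= [e1 e2].
  by congr (_, _); lia.
- apply/hasPn => -[k l] /allpairsP[[a b] /= [_ _ [-> ->]]].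
  apply/negP => h; have /allpairsP[[c d] /= [_ _ [e1 e2]]] : (a + b, a - b + 1) \in [seq (s + t, s - t) | s <- int_ball m, t <- int_ball m] := h; lia.
- apply: allpairs_uniq; rewrite ?uniq_int_ball // => -[a b] [c d] _ _ /= [e1 e2].
  by congr (_, _); lia.
Qed.

Lemma square_sub_diamond m : {subset square m <= diamond m}.
Proof.
move=> [k l]; rewrite mem_square => /andP[hk hl]; apply/mem_diamond.
have [s [e|e]] : exists s : int, k + l = s + s \/ k + l = s + s + 1.
  by exists ((k + l) %/ 2)%Z; lia.
  exists s, (k - s); split; [lia|lia|left; split; lia].
exists s, (k - s); split; [lia|lia|right; split; lia].
Qed.

Lemma diamond_sub_square m : {subset diamond m <= square m.*2.+1}.
Proof.
move=> [k l] /mem_diamond[s [t [hs ht h]]]; rewrite mem_square.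
by case: h => -[-> ->]; lia.
Qed.

(** The diamond lies between two squares, so the difference is bounded by the
    difference of the square partial sums of the series of moduli, which
    converge. *)
Lemma double_series_rearranged (F G : int -> C) : decays r F -> decays r G ->
  (fun m => \sum_(i <- square m.*2.+1) F i.1 * G i.2 -
            \sum_(i <- diamond m) F i.1 * G i.2) @ \oo --> (0 : C).
Proof.
move=> [D D0 hD] [E E0 hE].
have r01 := modulus_nome hp.
pose HF m := \sum_(k <- int_ball m) modulus (F k); pose HG m := \sum_(k <- int_ball m) modulus (G k).
have [k||a ha] := @bisumR_cvg _ _ r01 (fun k => modulus (F k)) D.
- by rewrite modulus_ge0 hD.
- by [].
have [k||b hb] := @bisumR_cvg _ _ r01 (fun k => modulus (G k)) E.
- by rewrite modulus_ge0 hE.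
- by [].
have big : (fun m : nat => m.*2.+1) @ \oo --> \oo.
  by move=> A [M _ hM]; exists M => // m /= Mm; apply: hM => /=; lia.
have sumsq m : \sum_(i <- square m) modulus (F i.1) * modulus (G i.2) = HF m * HG m.
  rewrite /square big_allpairs /= /HF /HG mulr_suml; apply: eq_bigr => k _.
  by rewrite mulr_sumr.
apply: (@modulus_squeeze _ _ _ (fun m => HF m.*2.+1 * HG m.*2.+1 - HF m * HG m)) => [m|].
  rewrite subr0.
  rewrite (big_subset_split _ (uniq_diamond m) (uniq_square _) (@diamond_sub_square m)).
  rewrite addrAC subrr add0r; apply: le_trans (modulus_sum _ _ _) _.
  rewrite -!sumsq.
  have sub : {subset square m <= square m.*2.+1}.
    by move=> i /square_sub_diamond; exact: diamond_sub_square.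
  rewrite (big_subset_split _ (uniq_square m) (uniq_square _) sub).
  rewrite addrAC subrr add0r [leLHS]big_mkcond [leRHS]big_mkcond /=; apply: ler_sum => i _.
  have [im|im] := boolP (i \in square m); first by rewrite square_sub_diamond.
  by case: ifP => _; rewrite ?modulusM // mulr_ge0 // modulus_ge0.
have ha2 : (fun m => HF m.*2.+1) @ \oo --> a by apply: (cvg_comp _ _ big); exact: ha.
have hb2 : (fun m => HG m.*2.+1) @ \oo --> b by apply: (cvg_comp _ _ big); exact: hb.
rewrite -(subrr (a * b)); apply: cvgB; [apply: cvgM|apply: cvgM] => //.
Qed.

(** Multiply the two theta series and sum along the diamonds: the even and the
    odd pairs each give a product of a function of X Y and one of X / Y. *)
Lemma theta_rank2_nome_neq0 : exists K : C, exists A B : C -> C, K != 0 /\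
  forall X Y, X != 0 -> Y != 0 ->
  K * (theta p X * theta p Y) = A (X * Y) * B (X / Y) - Y * (B (X * Y) * A (X / Y)).
Proof.
have r01 := modulus_nome hp.
have [P P0 hP] := qfact_cvg hp.
pose a z t : C := p ^ (t * (t - 1)) * z ^ t; pose b z t : C := p ^ (t * t) * z ^ t.
pose A z : C := lim ((fun m => \sum_(k <- int_ball m) a z k) @ \oo).
pose B z : C := lim ((fun m => \sum_(k <- int_ball m) b z k) @ \oo).
have hA z : z != 0 -> (fun m => \sum_(k <- int_ball m) a z k) @ \oo --> A z.
  move=> z0; have [l hl] := bisum_cvg r01 (sq1_decays hp p0 z0).
  by rewrite /A (cvg_lim _ hl).
have hB z : z != 0 -> (fun m => \sum_(k <- int_ball m) b z k) @ \oo --> B z.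
  move=> z0; have [l hl] := bisum_cvg r01 (sq_decays hp p0 z0).
  by rewrite /B (cvg_lim _ hl).
exists (P * P), A, B; split; first by rewrite mulf_neq0.
move=> X Y X0 Y0.
have XY0 : X * Y != 0 by rewrite mulf_neq0.
have XdY0 : X / Y != 0 by rewrite mulf_neq0 ?invr_eq0.
(* u = 0 gives the pairs with even sum, u = 1 those with odd sum. *)
have jj s t u : theta_term p X (s + t) * theta_term p Y (s - t + u) =
   (-1) ^ u * Y ^ u * p ^ (tri (s + t) + tri (s - t + u)) * ((X * Y) ^ s * (X / Y) ^ t).
  rewrite /theta_term.
  rewrite !expfzMl -expfV !expfzDr ?oppr_eq0 ?oner_eq0 // invr_expz.
  have -> : (-1) ^ (- t) = (-1) ^ t :> C by rewrite -exprz_inv invrN1.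
  have : (-1) ^ s * (-1) ^ s = 1 :> C by rewrite -expfzMl mulrNN mulr1 exp1rz.
  have : (-1) ^ t * (-1) ^ t = 1 :> C by rewrite -expfzMl mulrNN mulr1 exp1rz.
  set S := (-1) ^ s; set T := (-1) ^ t => TT SS.
  transitivity ((S * S) * (T * T) * ((-1) ^ u * Y ^ u * (p ^ tri (s + t) * p ^ tri (s - t + u)) *
    (X ^ s * Y ^ s * (X ^ t * Y ^ (- t))))); first by ring.
  by rewrite SS TT !mul1r.
have jj0 s t : theta_term p X (s + t) * theta_term p Y (s - t) = a (X * Y) s * b (X / Y) t.
  by have := jj s t 0; rewrite addr0 triDB !expr0z expfzDr // => ->; rewrite /a /b; ring.
have jj1 s t : theta_term p X (s + t) * theta_term p Y (s - t + 1) =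
    - (Y * (b (X * Y) s * a (X / Y) t)).
  by rewrite jj triDB1 !expr1z expfzDr // /a /b; ring.
have dsum m : \sum_(i <- diamond m) theta_term p X i.1 * theta_term p Y i.2 =
   (\sum_(s <- int_ball m) a (X * Y) s) * (\sum_(t <- int_ball m) b (X / Y) t) -
   Y * ((\sum_(s <- int_ball m) b (X * Y) s) * (\sum_(t <- int_ball m) a (X / Y) t)).
  rewrite /diamond big_cat /= !big_allpairs_dep /= !mulr_suml mulr_sumr -sumrN -!big_split /=.
  apply: eq_bigr => s _; rewrite !mulr_sumr -sumrN -!big_split /=; apply: eq_bigr => t _.
  by rewrite jj0 jj1.
have [hX hY] := (triple_product hp p0 X0 P0 hP, triple_product hp p0 Y0 P0 hP).
have big : (fun m : nat => m.*2.+1) @ \oo --> \oo.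
  by move=> S [M _ hM]; exists M => // m /= Mm; apply: hM => /=; lia.
have sumsq m : \sum_(i <- square m) theta_term p X i.1 * theta_term p Y i.2 =
    (\sum_(k <- int_ball m) theta_term p X k) * (\sum_(k <- int_ball m) theta_term p Y k).
  rewrite /square big_allpairs /= mulr_suml; apply: eq_bigr => k _.
  by rewrite mulr_sumr.
have lim1 : (fun m => \sum_(i <- square m.*2.+1) theta_term p X i.1 * theta_term p Y i.2) @ \oo
    --> P * theta p X * (P * theta p Y).
  rewrite (_ : (fun m => _) = (fun m => (\sum_(k <- int_ball m.*2.+1) theta_term p X k) *
     (\sum_(k <- int_ball m.*2.+1) theta_term p Y k))); last exact/funext.
  apply: cvgM; [apply: (cvg_comp _ _ big hX)|apply: (cvg_comp _ _ big hY)].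
have lim2 : (fun m => \sum_(i <- diamond m) theta_term p X i.1 * theta_term p Y i.2) @ \oo
    --> A (X * Y) * B (X / Y) - Y * (B (X * Y) * A (X / Y)).
  rewrite (_ : (fun m => _) = (fun m => (\sum_(s <- int_ball m) a (X * Y) s) * (\sum_(t <- int_ball m) b (X / Y) t) -
   Y * ((\sum_(s <- int_ball m) b (X * Y) s) * (\sum_(t <- int_ball m) a (X / Y) t)))); last exact/funext.
  apply: cvgB; first by apply: cvgM; [exact: hA|exact: hB].
  apply: cvgM; first exact: cvg_cst.
  by apply: cvgM; [exact: hB|exact: hA].
have lim3 := double_series_rearranged (theta_term_decays hp p0 X0) (theta_term_decays hp p0 Y0).
have E : P * theta p X * (P * theta p Y) -
    (A (X * Y) * B (X / Y) - Y * (B (X * Y) * A (X / Y))) = 0.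
  by apply: (cvg_unique (@norm_hausdorff _ _) (cvgB lim1 lim2)); exact: lim3.
by rewrite -(subr0_eq E); ring.
Qed.
End RankTwo.

Lemma theta_nome0 (R : realType) (X : Cx R) : theta 0 X = 1 - X.
Proof.
have h0 : `|0 : Cx R| < 1 by rewrite normr0 ltr01.
suff h : theta_trunc 0 X @ \oo --> (1 - X : Cx R).
  exact: (cvg_unique (@norm_hausdorff _ _) (@theta_cvg _ _ h0 X) h).
apply: (@modulus_squeeze _ _ _ (fun m => modulus X * 0 ^+ m)) => [m|]; last first.
  by apply: geometric_cvg0; rewrite lexx ltr01.
case: m => [|m].
  by rewrite /theta_trunc big_ord0 opprB addrCA subrr addr0 expr0 mulr1.
rewrite /theta_trunc big_ord_recl /= expr0 mulr1 expr1 mul0r subr0 mulr1 big1.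
  by rewrite mulr1 subrr modulus0 exprS mul0r mulr0.
by move=> i _; rewrite /bump /= !exprS !mul0r mulr0 !subr0 mulr1.
Qed.

(** The form of the addition formula needed here: for fixed X Y the products
    theta X * theta Y, as functions of X / Y, lie in the span of two
    functions. *)
Lemma theta_rank2 (R : realType) (p : Cx R) : `|p| < 1 ->
  exists K : Cx R, exists A B : Cx R -> Cx R, K != 0 /\
  forall X Y, X != 0 -> Y != 0 ->
  K * (theta p X * theta p Y) = A (X * Y) * B (X / Y) - Y * (B (X * Y) * A (X / Y)).
Proof.
move=> hp; have [->|p0] := eqVneq p 0; last exact: theta_rank2_nome_neq0.
exists 1, (fun z => 1 + z), (fun=> 1); split; first exact: oner_neq0.
by move=> X Y X0 Y0; rewrite !theta_nome0; field.
Qed.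

(** * Interpolation by binary forms *)

Local Close Scope complex_scope.
Local Close Scope classical_set_scope.

Section BinaryForms.
Variables (F : fieldType) (u v : F -> F).
Implicit Types (G : F -> F) (M : nat).

(** On nonzero arguments, G is a homogeneous polynomial of degree M in u and
    v. *)
Fixpoint form M G : Prop :=
  match M with
  | 0 => exists c, forall d, d != 0 -> G d = c
  | M'.+1 => exists G1 G2, [/\ form M' G1, form M' G2 &
      forall d, d != 0 -> G d = u d * G1 d + v d * G2 d]
  end.

Lemma form_ext M G G' : (forall d, d != 0 -> G d = G' d) -> form M G -> form M G'.
Proof.
case: M => [|M] GG' /=.
  by move=> [c hc]; exists c => d d0; rewrite -GG' // hc.
by move=> [G1 [G2 [h1 h2 h]]]; exists G1, G2; split=> // d d0; rewrite -GG' // h.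
Qed.

Lemma form_cst c : form 0 (fun=> c). Proof. by exists c. Qed.

Lemma form_add M G G' : form M G -> form M G' -> form M (fun d => G d + G' d).
Proof.
elim: M G G' => [|M IH] G G' /=.
  by move=> [c hc] [c' hc']; exists (c + c') => d d0; rewrite hc // hc'.
move=> [G1 [G2 [h1 h2 h]]] [G1' [G2' [h1' h2' h']]].
exists (fun d => G1 d + G1' d), (fun d => G2 d + G2' d); split; [exact: IH|exact: IH|].
by move=> d d0; rewrite h // h' //; ring.
Qed.

Lemma form_mul M M' G G' : form M G -> form M' G' ->
  form (M + M') (fun d => G d * G' d).
Proof.
move=> + hG'; elim: M G => [|M IH] G /=.
  rewrite add0n => -[c hc]; apply: (@form_ext _ (fun d => c * G' d)).
    by move=> d d0; rewrite hc.
  elim: M' {hc} G' hG' => [|M' IH] G' /=.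
    by move=> [c' hc']; exists (c * c') => d d0; rewrite hc'.
  move=> [G1 [G2 [h1 h2 h]]]; exists (fun d => c * G1 d), (fun d => c * G2 d).
  by split; [exact: IH|exact: IH|move=> d d0; rewrite h //; ring].
move=> [G1 [G2 [h1 h2 h]]]; exists (fun d => G1 d * G' d), (fun d => G2 d * G' d).
by split; [exact: IH|exact: IH|move=> d d0; rewrite h //; ring].
Qed.

Lemma form_scale M G c : form M G -> form M (fun d => c * G d).
Proof. exact: form_mul (form_cst c). Qed.

Lemma form_zero M : form M (fun=> 0).
Proof.
elim: M => [|M IH]; first by exists 0.
by exists (fun=> 0), (fun=> 0); split=> // d _; rewrite !mulr0 addr0.
Qed.

Lemma form_sum M (I : eqType) (s : seq I) (G : I -> F -> F) :
  (forall i, i \in s -> form M (G i)) -> form M (fun d => \sum_(i <- s) G i d).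
Proof.
elim: s => [_|i s IH hG].
  by apply: form_ext (form_zero M) => d _; rewrite big_nil.
apply: (@form_ext _ (fun d => G i d + \sum_(j <- s) G j d)).
  by move=> d _; rewrite big_cons.
apply: form_add; first by apply: hG; rewrite mem_head.
by apply: IH => j js; apply: hG; rewrite inE js orbT.
Qed.

Lemma form_prod (I : Type) (s : seq I) (m : I -> nat) (G : I -> F -> F) :
  (forall i, form (m i) (G i)) ->
  form (\sum_(i <- s) m i) (fun d => \prod_(i <- s) G i d).
Proof.
move=> hG; elim: s => [|i s IH].
  by rewrite big_nil; exists 1 => d _; rewrite big_nil.
rewrite big_cons; apply: (@form_ext _ (fun d => G i d * \prod_(j <- s) G j d)).
  by move=> d _; rewrite big_cons.
exact: form_mul.
Qed.

Lemma form_linear a b : form 1 (fun d => a * u d + b * v d).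
Proof.
exists (fun=> a), (fun=> b); split; [exact: form_cst|exact: form_cst|].
by move=> d _; ring.
Qed.

Definition wronskian d d' := u d * v d' - u d' * v d.

(** Write u and v through the linear form vanishing at d0 and one equal to 1
    there: G is then a multiple of the first plus a multiple of the M.+1-st
    power of the second, and the latter coefficient is G d0. *)
Lemma form_factor M G d0 d1 : d0 != 0 -> wronskian d0 d1 != 0 ->
  form M.+1 G -> G d0 = 0 ->
  exists2 G', form M G' & forall d, d != 0 -> G d = wronskian d d0 * G' d.
Proof.
move=> d00 W; set l0 := fun d => wronskian d d0.
have [al [be [l1 [hl1 l1E hu hv]]]] : exists al be, exists l1 : F -> F,
    [/\ form 1 l1, l1 d0 = 1, forall d, u d = al * l0 d + u d0 * l1 d &
        forall d, v d = be * l0 d + v d0 * l1 d].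
  have [u0|u0] := eqVneq (u d0) 0; last first.
    exists 0, (- (u d0)^-1), (fun d => (u d0)^-1 * u d + 0 * v d).
    split; first exact: form_linear.
    - by rewrite mul0r addr0 mulVf.
    - by move=> d; field.
    - by move=> d; rewrite /l0 /wronskian; field.
  have v0 : v d0 != 0.
    by apply: contra W => /eqP v0; rewrite /wronskian u0 v0 mul0r mulr0 subrr.
  exists (v d0)^-1, 0, (fun d => 0 * u d + (v d0)^-1 * v d).
  split; first exact: form_linear.
  - by rewrite mul0r add0r mulVf.
  - by move=> d; rewrite /l0 /wronskian; field.
  - by move=> d; field.
have l1X m : form m (fun d => l1 d ^+ m).
  elim: m => [|m IH]; first exact: form_cst.
  apply: (@form_ext _ (fun d => l1 d * l1 d ^+ m)) => [d _|]; first by rewrite exprS.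
  exact: (form_mul hl1 IH).
have decomp m G1 : form m.+1 G1 -> exists G' c, form m G' /\
    forall d, d != 0 -> G1 d = l0 d * G' d + c * l1 d ^+ m.+1.
  elim: m G1 => [|m IH] G1 [Ga [Gb [ha hb h]]].
    case: ha => ca ha; case: hb => cb hb.
    exists (fun=> al * ca + be * cb), (u d0 * ca + v d0 * cb); split; first exact: form_cst.
    by move=> d d_0; rewrite h // ha // hb // (hu d) (hv d) expr1; ring.
  have [A [ca [hA EA]]] := IH _ ha; have [B [cb [hB EB]]] := IH _ hb.
  exists (fun d => (u d * A d + v d * B d) + (al * ca + be * cb) * l1 d ^+ m.+1).
  exists (u d0 * ca + v d0 * cb); split.
    by apply: form_add; [exists A, B|exact: form_scale].
  by move=> d d_0; rewrite h // EA // EB // !exprS; rewrite (hu d) (hv d); ring.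
move=> hG G0; have [G' [c [hG' E]]] := decomp _ _ hG.
have c0 : c = 0.
  have := E _ d00; rewrite G0 l1E expr1n mulr1 /l0 /wronskian subrr mul0r add0r.
  by move=> <-.
by exists G' => // d d_0; rewrite E // c0 mul0r addr0.
Qed.

(** Dividing by the linear form of one zero keeps the others, because their
    wronskians with it do not vanish. *)
Lemma form_eq0 (M : nat) (G : F -> F) (s : seq F) : form M G -> size s = M.+1 ->
  (forall d, d \in s -> d != 0) ->
  pairwise (fun d d' => wronskian d d' != 0) s ->
  (forall d, d \in s -> G d = 0) -> forall d, d != 0 -> G d = 0.
Proof.
elim: M G s => [|M IH] G [|d0 s] // hG [ss] s0 /= /andP[W0 Ws] Gs d d_0.
  case: hG => c hc; rewrite hc // -(hc d0) ?Gs ?mem_head //.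
  by rewrite s0 ?mem_head.
have d00 : d0 != 0 by rewrite s0 ?mem_head.
case: s ss s0 W0 Ws Gs => [|d1 s] // ss s0 W0 Ws Gs.
have W01 : wronskian d0 d1 != 0 by case/andP: W0.
have [G' hG' E] := form_factor d00 W01 hG (Gs _ (mem_head _ _)).
have s0' t : t \in d1 :: s -> t != 0 by move=> ts; apply: s0; rewrite inE ts orbT.
rewrite E // (IH G' (d1 :: s)) ?mulr0 // => t ts.
have := Gs t; rewrite inE ts orbT => /(_ isT); rewrite E ?s0' // => /eqP.
rewrite mulf_eq0 => /orP[|/eqP //]; have /allP/(_ _ ts) := W0.
by rewrite /wronskian -opprB oppr_eq0 => /negPf; rewrite mulrC [v _ * _]mulrC => ->.
Qed.

End BinaryForms.

(** * Multi-indices *)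

Section MultiIndices.
Variable n : nat.
Implicit Types (j k N : multi n) (r : 'I_n).

Definition madd k j : multi n := [ffun r => (k r + j r)%N].
Definition mzero : multi n := [ffun=> 0%N].
Definition mpoint (r0 : 'I_n) (i : nat) : multi n := [ffun r => if r == r0 then i else 0%N].

Lemma mleP j k : reflect (forall r, (j r <= k r)%N) (mle j k).
Proof. exact: forallP. Qed.

Lemma mle0 k : mle mzero k.
Proof. by apply/mleP => r; rewrite ffunE. Qed.

Lemma mle_trans j k N : mle j k -> mle k N -> mle j N.
Proof. by move=> /mleP jk /mleP kN; apply/mleP => r; apply: leq_trans (kN r). Qed.

Lemma mle_addl k j : mle j (madd k j).
Proof. by apply/mleP => r; rewrite ffunE leq_addl. Qed.

Lemma mle_add2 j k N : mle (madd k j) (madd N j) = mle k N.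
Proof. by apply/mleP/mleP => h r; have := h r; rewrite !ffunE leq_add2r. Qed.

Lemma mle_addP j N : mle j N -> exists N0, N = madd N0 j.
Proof.
move=> /mleP jN; exists [ffun r => (N r - j r)%N].
by apply/ffunP => r; rewrite !ffunE subnK.
Qed.

Lemma madd_inj j : injective (fun k => madd k j).
Proof. by move=> k k' /ffunP e; apply/ffunP => r; have := e r; rewrite !ffunE => /addIn. Qed.

Lemma add0m j : madd mzero j = j.
Proof. by apply/ffunP => r; rewrite !ffunE. Qed.

Lemma msizeD k j : msize (madd k j) = (msize k + msize j)%N.
Proof. by rewrite /msize -big_split; apply: eq_bigr => r _; rewrite ffunE. Qed.

Lemma msize0 : msize mzero = 0%N.
Proof. by rewrite /msize big1 // => r _; rewrite ffunE. Qed.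

Lemma msize_eq0 k : msize k = 0%N -> k = mzero.
Proof.
move=> k0; apply/ffunP => r; rewrite ffunE; apply/eqP; rewrite -leqn0 -k0.
by rewrite /msize (bigD1 r) //= leq_addr.
Qed.

Lemma msize_point r0 i : msize (mpoint r0 i) = i.
Proof.
rewrite /msize (bigD1 r0) //= ffunE eqxx big1 ?addn0 // => r /negPf rr0.
by rewrite ffunE rr0.
Qed.

(** Polarisation of the quadratic form mcross; the diagonal terms are moved to
    the left so that no truncated subtraction occurs. *)
Lemma mcrossD k j : (mcross (madd k j) + \sum_(r < n) k r * j r =
  mcross k + mcross j + msize k * msize j)%N.
Proof.
have -> : (msize k * msize j = \sum_(r < n) k r * j r +
    \sum_(r < n) \sum_(s < n | r < s) (k r * j s + j r * k s))%N.
  rewrite /msize big_distrl /=.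
  under eq_bigr => r _ do rewrite big_distrr /= (bigD1 r) //=.
  rewrite big_split /=; congr (_ + _)%N.
  under [RHS]eq_bigr => r _ do rewrite big_split /=.
  rewrite big_split /= [X in (_ = _ + X)%N](exchange_big_dep predT) //= -big_split /=.
  apply: eq_bigr => r _; rewrite (bigID (fun s : 'I_n => (r < s)%N)) /=; congr (_ + _)%N.
    by apply: eq_bigl => s; rewrite -val_eqE /=; case: ltngtP.
  apply: eq_big => s; last by rewrite mulnC.
  by rewrite -val_eqE /=; case: ltngtP.
suff -> : mcross (madd k j) = (mcross k + mcross j +
    \sum_(r < n) \sum_(s < n | (r < s)%N) (k r * j s + j r * k s))%N by lia.
rewrite /mcross -!big_split; apply: eq_bigr => r _.
rewrite -!big_split; apply: eq_bigr => s _; rewrite !ffunE /=; lia.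
Qed.

Lemma mcross_point r0 i : mcross (mpoint r0 i) = 0%N.
Proof.
rewrite /mcross big1 // => r _; rewrite big1 // => s rs; rewrite !ffunE.
by case: eqP rs => [->|_ _] //; case: eqP => [->|_]; rewrite ?ltnn ?muln0.
Qed.

Lemma mcross0 : mcross mzero = 0%N.
Proof. by rewrite /mcross big1 // => r _; rewrite big1 // => s _; rewrite !ffunE. Qed.

Definition box N : seq (multi n) :=
  [seq [ffun r => k r : nat] | k : {dffun forall r : 'I_n, 'I_(N r).+1}].

Lemma box_sumE (V : nmodType) N (G : multi n -> V) :
  box_sum N G = \sum_(k <- box N) G k.
Proof. by rewrite /box_sum /box big_image. Qed.

Lemma mem_box N k : (k \in box N) = mle k N.
Proof.
apply/fintype.imageP/mleP => [[f _ ->] r|kN]; first by rewrite ffunE -ltnS.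
exists (finfun (fun r => inord (k r)) : {dffun forall r : 'I_n, 'I_(N r).+1}) => //.
by apply/ffunP => r; rewrite !ffunE inordK // ltnS.
Qed.

Lemma uniq_box N : uniq (box N).
Proof.
rewrite map_inj_uniq ?enum_uniq // => f g /ffunP e; apply/ffunP => r.
by apply: val_inj; have := e r; rewrite !ffunE.
Qed.

Lemma box_sub (V : nmodType) N k (G : multi n -> V) : mle k N ->
  \sum_(j <- box k) G j = \sum_(j <- box N | mle j k) G j.
Proof.
move=> kN; rewrite -[RHS]big_filter; apply: perm_big; apply: uniq_perm.
- exact: uniq_box.
- exact/filter_uniq/uniq_box.
move=> j; rewrite mem_filter !mem_box; apply/idP/andP => [jk|[] //].
by split=> //; exact: mle_trans kN.
Qed.

Lemma box_shift (V : nmodType) N j (G : multi n -> V) :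
  \sum_(k <- box (madd N j) | mle j k) G k = \sum_(k <- box N) G (madd k j).
Proof.
rewrite -[LHS]big_filter -(big_map (fun k => madd k j) xpredT).
apply: perm_big; apply: uniq_perm.
- exact/filter_uniq/uniq_box.
- by rewrite map_inj_uniq ?uniq_box //; exact: madd_inj.
move=> k; rewrite mem_filter mem_box; apply/andP/mapP => [[jk kN]|[k0 h ->]].
  have [k0 kE] := mle_addP jk; exists k0 => //.
  by rewrite mem_box -(mle_add2 j) -kE.
by rewrite mle_addl mle_add2 -mem_box.
Qed.

End MultiIndices.

(** * The summand of the Jackson sum and its shifts *)

Section Summand.
Variables (F : fieldType) (th : F -> F) (q : F) (n : nat).
Hypothesis q0 : q != 0.
Implicit Types (a b c d e f : F) (x : 'I_n -> F) (j k N : multi n) (r s : 'I_n).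

Definition poch a m : F := \prod_(i < m) th (a * q ^+ i).

Lemma poch0 a : poch a 0 = 1. Proof. by rewrite /poch big_ord0. Qed.

Lemma pochS a m : poch a m.+1 = th a * poch (a * q) m.
Proof.
rewrite /poch big_ord_recl expr0 mulr1; congr (_ * _); apply: eq_bigr => i _.
by rewrite /bump /= exprS mulrA.
Qed.

Lemma pochD a m l : poch a (m + l) = poch a m * poch (a * q ^+ m) l.
Proof.
rewrite /poch big_split_ord /=; congr (_ * _); apply: eq_bigr => i _.
by rewrite exprD mulrA.
Qed.

Lemma pochD_eq a m l a' : a' = a * q ^+ m -> poch a (m + l) = poch a m * poch a' l.
Proof. by move=> ->; exact: pochD. Qed.

Lemma poch_neq0 a m : (forall i, (i < m)%N -> th (a * q ^+ i) != 0) -> poch a m != 0.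
Proof. by move=> h; apply/prodf_neq0 => i _; apply: h. Qed.

Lemma poch_eq0 a m i : (i < m)%N -> th (a * q ^+ i) = 0 -> poch a m = 0.
Proof. by move=> im h; rewrite /poch (bigD1 (Ordinal im)) //= h mul0r. Qed.

Let qX m : q ^+ m != 0. Proof. by rewrite expf_neq0. Qed.

(** Lowering the summation range from j to 0 multiplies x_r by q^{j_r}. *)
Definition shift x j r := x r * q ^+ j r.

(** [xfact] with truncated differences in place of integral indices. *)
Definition typeA x k j : F :=
  \prod_(r < n) \prod_(s < n)
    poch (q ^ (1 + (j r)%:Z - (j s)%:Z) * x r / x s) (k r - j r).

(** The very-well-poised part; for j = 0 it is the one of the Jackson sum, while
    general j occurs in the product of the coefficient of beta_k and
    B1_{kj}. *)
Definition vwp b c x N k j : F :=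
  \prod_(r < n) (th (c * x r * q ^+ (k r + msize k))
    * poch (b * x r * q ^ ((k r)%:Z - (msize k)%:Z) / c) (N r - k r)
    * (poch (c * x r) (j r + msize k) / poch (c * x r) (N r + msize k).+1)).

Definition typeD b x N k : F :=
  (\prod_(r < n) \prod_(s < n) poch (b * x r * x s) (N s + k r)) /
  (\prod_(r < n) \prod_(s < n | (r < s)%N) poch (b * x r * x s) (k r + k s)).

Definition powers b c x k : F :=
  (b / c) ^+ msize k * (\prod_(r < n) x r ^+ k r) * q ^- mcross k.

(** The factors depending on one of the three free parameters d, e, f, with the
    denominators (c q x_r / d)_{k_r} cleared against (c q x_r / d)_{N_r}. *)
Definition flank c x N k d : F :=
  poch d (msize k) * \prod_(r < n) poch (c * q * x r * q ^+ k r / d) (N r - k r).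

(** Only differences of indices and quotients of the x_r occur. *)
Lemma typeA_shift x k j i : (forall r, x r != 0) ->
  typeA x (madd k j) (madd i j) = typeA (shift x j) k i.
Proof.
move=> x0; apply: eq_bigr => r _; apply: eq_bigr => s _.
rewrite !ffunE /shift subnDr; congr (poch _ _).
have -> : 1 + (i r + j r)%:Z - (i s + j s)%:Z =
    (1 + (i r)%:Z - (i s)%:Z) + ((j r)%:Z - (j s)%:Z) by lia.
rewrite expfzDr // [q ^ ((j r)%:Z - _)]expfzDr // -exprnN -exprnP.
by field; rewrite x0 qX.
Qed.

Lemma typeA_self x j : typeA x j j = 1.
Proof. by rewrite /typeA big1 // => r _; rewrite big1 // => s _; rewrite subnn poch0. Qed.

(** The initial segments (c x_r)_{j_r + |j|} of numerator and denominator
    cancel. *)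
Lemma vwp_shift b c x N k j : c != 0 ->
  (forall r m, poch (c * x r) m != 0) ->
  vwp b c x (madd N j) (madd k j) j =
  vwp b (c * q ^+ msize j) (shift x j) N k (mzero n).
Proof.
move=> c0 cx; apply: eq_bigr => r _; rewrite !ffunE msizeD /shift subnDr add0n.
congr (_ * _ * _).
- by congr th; rewrite !exprD; ring.
- congr (poch _ _).
  have -> : (k r + j r)%:Z - (msize k + msize j)%:Z =
    ((k r)%:Z - (msize k)%:Z) + ((j r)%:Z - (msize j)%:Z) by lia.
  rewrite expfzDr // [q ^ ((j r)%:Z - _)]expfzDr // -exprnN -exprnP.
  by field; rewrite c0 qX.
have -> : (j r + (msize k + msize j) = (j r + msize j) + msize k)%N by lia.
have -> : (N r + j r + (msize k + msize j)).+1 =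
  ((j r + msize j) + (N r + msize k).+1)%N by lia.
have E : c * q ^+ msize j * (x r * q ^+ j r) = c * x r * q ^+ (j r + msize j).
  by rewrite exprD; ring.
rewrite !(@pochD_eq _ (j r + msize j) _ _ E).
by rewrite -mulf_div divff // mul1r.
Qed.

Lemma typeD_shift b x N k j :
  typeD b x (madd N j) (madd k j) = typeD b x j j * typeD b (shift x j) N k.
Proof.
rewrite /typeD mulf_div -!big_split /=; congr (_ / _).
  apply: eq_bigr => r _; rewrite -big_split; apply: eq_bigr => s _ /=.
  rewrite !ffunE /shift (_ : N s + j s + (k r + j r) = (j s + j r) + (N s + k r))%N; last by lia.
  by apply: pochD_eq; rewrite exprD; ring.
apply: eq_bigr => r _; rewrite -big_split; apply: eq_bigr => s _ /=.
rewrite !ffunE /shift (_ : k r + j r + (k s + j s) = (j r + j s) + (k r + k s))%N; last by lia.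
by apply: pochD_eq; rewrite exprD; ring.
Qed.

Lemma powers_shift b c x k j : c != 0 ->
  powers b c x (madd k j) = powers b c x j * powers b (c * q ^+ msize j) (shift x j) k.
Proof.
move=> c0; rewrite /powers msizeD.
have -> : \prod_(r < n) x r ^+ (madd k j) r =
    (\prod_(r < n) x r ^+ k r) * (\prod_(r < n) x r ^+ j r).
  by rewrite -big_split; apply: eq_bigr => r _; rewrite ffunE exprD.
have -> : \prod_(r < n) shift x j r ^+ k r =
    (\prod_(r < n) x r ^+ k r) * q ^+ (\sum_(r < n) k r * j r).
  rewrite -prodrXr -big_split; apply: eq_bigr => r _.
  by rewrite /shift exprMn -exprM mulnC.
have E : q ^+ mcross (madd k j) * q ^+ (\sum_(r < n) k r * j r) =
    q ^+ mcross k * q ^+ mcross j * q ^+ (msize j * msize k).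
  by rewrite -!exprD mcrossD mulnC.
have -> : q ^- mcross (madd k j) =
    q ^+ (\sum_(r < n) k r * j r) / (q ^+ mcross k * q ^+ mcross j * q ^+ (msize j * msize k)).
  by rewrite -E; field; rewrite !qX.
have -> : (b / (c * q ^+ msize j)) ^+ msize k = (b / c) ^+ msize k / q ^+ (msize j * msize k).
  by rewrite invfM mulrA exprMn exprVn -exprM.
rewrite exprD; move: ((b / c) ^+ _) ((b / c) ^+ _) => u v.
by field; rewrite !qX.
Qed.

Lemma flank_shift c x N k j d : d != 0 ->
  flank c x (madd N j) (madd k j) d =
  poch d (msize j) * flank (c * q ^+ msize j) (shift x j) N k (d * q ^+ msize j).
Proof.
move=> d0; rewrite /flank msizeD addnC pochD -!mulrA; congr (_ * (_ * _)).
apply: eq_bigr => r _; rewrite !ffunE subnDr /shift; congr (poch _ _).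
by rewrite exprD; field; rewrite d0 qX.
Qed.

Definition weight b c x N k : F :=
  vwp b c x N k (mzero n) * typeD b x N k / (typeA x N k * typeA x k (mzero n)) * powers b c x k.

Definition summand b c x N d e f k : F :=
  weight b c x N k * (flank c x N k d * flank c x N k e * flank c x N k f).

Definition closed_form b c x N d e f : F :=
  \prod_(r < n) (poch (b * d * x r / c) (N r) * poch (b * e * x r / c) (N r)
    * poch (b * f * x r / c) (N r)) * typeD b x N (mzero n) / typeA x N (mzero n).

(** The elliptic D_n Jackson sum, to be proved under the balancing condition
    b d e f = c^2 q. The summand and the right-hand side are symmetric in
    d, e, f. *)
Definition Jackson_sum b c x N d e f :=
  \sum_(k <- box N) summand b c x N d e f k = closed_form b c x N d e f.

(** The nonvanishing of the denominators of [weight], in a form stable under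
    [shift]. *)
Definition generic b c x : Prop :=
  [/\ [/\ b != 0, c != 0 & forall r, x r != 0],
      forall r i, th (c * x r * q ^+ i) != 0,
      forall r s i, r != s -> th (b * x r * x s * q ^+ i) != 0 &
      forall r s (i : int), (r != s) || (i != 0) -> th (q ^ i * x r / x s) != 0].

Lemma generic_poch b c x : generic b c x -> forall r m, poch (c * x r) m != 0.
Proof. by move=> [_ h _ _] r m; apply: poch_neq0. Qed.

Lemma generic_typeA b c x k j : generic b c x -> typeA x k j != 0.
Proof.
move=> [_ _ _ h]; apply/prodf_neq0 => r _; apply/prodf_neq0 => s _.
apply: poch_neq0 => i _.
rewrite (_ : _ * q ^+ i = q ^ (1 + (j r)%:Z - (j s)%:Z + i%:Z) * x r / x s).
  by apply: h; case: eqP => [->|//]; lia.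
by rewrite [in RHS]expfzDr // -exprnP; ring.
Qed.

Lemma generic_shift b c x j :
  generic b c x -> generic b (c * q ^+ msize j) (shift x j).
Proof.
move=> [[b0 c0 x0] h1 h2 h3]; split.
- by split=> // [|r]; rewrite mulf_neq0.
- move=> r i; rewrite /shift.
  rewrite (_ : _ * q ^+ i = c * x r * q ^+ (msize j + j r + i)) //.
  by rewrite !exprD; ring.
- move=> r s i rs; rewrite /shift.
  rewrite (_ : _ * q ^+ i = b * x r * x s * q ^+ (j r + j s + i)) ?h2 //.
  by rewrite !exprD; ring.
move=> r s i rs; rewrite /shift.
rewrite (_ : _ / _ = q ^ (i + (j r)%:Z - (j s)%:Z) * x r / x s).
  by apply: h3; case: eqP rs => [->|//] /=; lia.
by rewrite !expfzDr // -exprnN -exprnP; field; rewrite qX x0.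
Qed.

Lemma Jackson_sum_sym b c x N d e f :
  Jackson_sum b c x N d e f -> Jackson_sum b c x N e d f.
Proof.
rewrite /Jackson_sum => h; transitivity (closed_form b c x N d e f).
  by rewrite -h; apply: eq_bigr => k _; rewrite /summand; ring.
rewrite /closed_form; congr (_ * _ / _); apply: eq_bigr => r _; ring.
Qed.

End Summand.

(** * Reduction of the Jackson sum at a node *)

(** Used for the type D denominators at a multi-index supported at r0. *)
Lemma prod_pairs_through (F : comNzRingType) n (r0 : 'I_n) (g : 'I_n -> 'I_n -> F) :
  (forall r s, g r s = g s r) -> (forall r s, r != r0 -> s != r0 -> g r s = 1) ->
  \prod_(r < n) \prod_(s < n | (r < s)%N) g r s = \prod_(s < n | s != r0) g r0 s.
Proof.
move=> gC g1; rewrite (bigD1 r0) //= [RHS](bigID (fun s : 'I_n => (r0 < s)%N)) /=.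
congr (_ * _).
  by apply: eq_bigl => s; rewrite -val_eqE /=; case: ltngtP.
rewrite [RHS](eq_bigl (fun s : 'I_n => (s != r0) && (s < r0)%N)); last first.
  by move=> s; rewrite -val_eqE /=; case: ltngtP.
rewrite [RHS]big_mkcondr; apply: eq_bigr => r rr0.
have [lt|ge] := ltnP r r0.
  rewrite (bigD1 r0) //= big1 ?mulr1 1?gC // => s /andP[_ sr0].
  exact: g1.
rewrite big1 // => s rs; apply: g1 => //; apply/eqP => E.
by move: rs; rewrite E ltnNge ge.
Qed.

Section Reduction.
Variables (F : fieldType) (th : F -> F) (q : F) (n : nat).
Hypotheses (q0 : q != 0) (th1 : th 1 = 0).
Hypothesis thV : forall a, a != 0 -> th a^-1 = - a^-1 * th a.
Implicit Types (a b c d e f : F) (x : 'I_n -> F) (j k N : multi n) (r s : 'I_n).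

Local Notation poch := (poch th q).
Local Notation typeA := (typeA th q).
Local Notation vwp := (vwp th q).
Local Notation typeD := (typeD th q).
Local Notation powers := (powers q).
Local Notation flank := (flank th q).
Local Notation weight := (weight th q).
Local Notation summand := (summand th q).
Local Notation closed_form := (closed_form th q).
Local Notation Jackson_sum := (Jackson_sum th q).
Local Notation generic := (generic th q).
Local Notation shift := (shift q).
Local Notation mzero := (mzero n).

Let qX m : q ^+ m != 0. Proof. by rewrite expf_neq0. Qed.

(** The factor (d)_{|k|} vanishes at d = 1 unless k = 0, and the balancing
    condition exchanges c q / e with b f / c. *)
Lemma Jackson_at1 b c x N e f : generic b c x -> e != 0 -> f != 0 ->
  b * e * f = c ^+ 2 * q -> Jackson_sum b c x N 1 e f.
Proof.
move=> gen e0 f0 bal; have [[b0 c0 x0] cx _ _] := gen.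
rewrite /Jackson_sum (bigD1_seq mzero) /=; last 2 first.
- by rewrite mem_box mle0.
- exact: uniq_box.
rewrite big1 ?addr0 => [|k k0]; last first.
  rewrite /summand {1}/flank.
  case E : (msize k) => [|m]; first by rewrite (msize_eq0 E) eqxx in k0.
  by rewrite pochS th1 !mul0r mulr0.
rewrite /summand /weight /closed_form typeA_self mulr1.
have -> : powers b c x mzero = 1.
  rewrite /powers msize0 mcross0 big1 ?invr1 ?mulr1 // => r _.
  by rewrite ffunE.
set S := typeD _ _ _ _; set X := typeA _ _ _.
suff E : vwp b c x N mzero mzero *
    (flank c x N mzero 1 * flank c x N mzero e * flank c x N mzero f) =
  \prod_(r < n) (poch (b * 1 * x r / c) (N r) * poch (b * e * x r / c) (N r)
    * poch (b * f * x r / c) (N r)) by rewrite -E; ring.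
rewrite /vwp /flank msize0 !poch0 !mul1r -!big_split; apply: eq_bigr => r _ /=.
rewrite !ffunE !addn0 !subn0 !expr0 subrr expr0z poch0 !mulr1 pochS.
have -> : c * q * x r / e = b * f * x r / c.
  apply/eqP; rewrite eqr_div //; apply/eqP.
  transitivity (c ^+ 2 * q * x r); [by ring|rewrite -bal; ring].
have -> : c * q * x r / f = b * e * x r / c.
  apply/eqP; rewrite eqr_div //; apply/eqP.
  transitivity (c ^+ 2 * q * x r); [by ring|rewrite -bal; ring].
rewrite divr1 (_ : c * x r * q = c * q * x r); last by ring.
have h1 : th (c * x r) != 0 by have := cx r 0%N; rewrite expr0 mulr1.
have h2 : poch (c * q * x r) (N r) != 0.
  have := generic_poch gen r (N r).+1; rewrite pochS mulf_eq0 negb_or => /andP[_].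
  by rewrite (_ : c * x r * q = c * q * x r) //; ring.
by field; rewrite h1 h2.
Qed.

Lemma poch_reflect a m : a != 0 ->
  poch (a * q ^+ m)^-1 m.+1 = (\prod_(i < m.+1) - (a * q ^+ i)^-1) * poch a m.+1.
Proof.
move=> a0; rewrite /poch (reindex_inj rev_ord_inj) -big_split; apply: eq_bigr => i _ /=.
rewrite -thV ?mulf_neq0 //; congr th.
have im : (i <= m)%N by rewrite -ltnS.
rewrite subSS (_ : q ^+ m = q ^+ (m - i) * q ^+ i); last by rewrite -exprD subnK.
by field; rewrite a0 !qX.
Qed.

Lemma prod_reflect a a' t m : a * a' * q ^+ m = t ->
  (\prod_(i < m.+1) (a * q ^+ i)) * (\prod_(i < m.+1) (a' * q ^+ i)) = t ^+ m.+1.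
Proof.
move=> <-; rewrite [X in _ * X](reindex_inj rev_ord_inj) -big_split /=.
rewrite -[X in _ = _ ^+ X]card_ord -prodr_const; apply: eq_bigr => i _.
have im : (i <= m)%N by rewrite -ltnS.
rewrite subSS (_ : q ^+ m = q ^+ (m - i) * q ^+ i); last by rewrite -exprD subnK.
by ring.
Qed.

Section Step.
Variables (b c : F) (x : 'I_n -> F) (N0 : multi n) (r0 : 'I_n) (i : nat).
Hypothesis gen : generic b c x.

Let j := mpoint r0 i.+1.
Let N := madd N0 j.
Let c' := c * q ^+ i.+1.
Let x' := shift x j.
Let d := c * x r0 * q ^+ i.+1.

Let b0 : b != 0. Proof. by have [[]] := gen. Qed.
Let c0 : c != 0. Proof. by have [[]] := gen. Qed.
Let x0 r : x r != 0. Proof. by have [[]] := gen. Qed.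
Let d0 : d != 0. Proof. by rewrite !mulf_neq0. Qed.
Let j0 : j r0 = i.+1. Proof. by rewrite ffunE eqxx. Qed.
Let j1 r : r != r0 -> j r = 0%N. Proof. by move=> /negPf h; rewrite ffunE h. Qed.
Let jsize : msize j = i.+1. Proof. exact: msize_point. Qed.
Let zE r : mzero r = 0%N. Proof. by rewrite ffunE. Qed.
Let NE r : N r = (N0 r + j r)%N. Proof. by rewrite ffunE. Qed.

(** At d = c x_{r0} q^{i+1} the factor (c q^{1+k_r} x_r / d)_{N_r-k_r} for r = r0
    contains theta 1 whenever k_{r0} <= i. *)
Lemma flank_vanish k : mle k N -> ~~ mle j k -> flank c x N k d = 0.
Proof.
move=> /mleP kN jk; have ki : (k r0 <= i)%N.
  rewrite leqNgt; apply: contra jk => ik; apply/mleP => r.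
  by have [->|/j1 ->] := eqVneq r r0; rewrite ?j0.
have lt : (i - k r0 < N r0 - k r0)%N by rewrite NE j0; lia.
rewrite /flank (bigD1 r0) //= (poch_eq0 lt) ?mul0r ?mulr0 //.
rewrite -[RHS]th1; congr th; rewrite /d.
have -> : q ^+ i.+1 = q * (q ^+ k r0 * q ^+ (i - k r0)) by rewrite -exprD subnKC // exprS.
by field; rewrite c0 x0 q0 !qX.
Qed.

(** At the node, (d)_{|k|} is a segment of (c x_{r0})_m and absorbs the change
    of j. *)
Lemma vwp_point k : vwp b c x N (madd k j) mzero * poch d (msize (madd k j)) =
  vwp b c x N (madd k j) j * poch d (msize k).
Proof.
set K := madd k j; have KE : msize K = (i.+1 + msize k)%N by rewrite msizeD jsize addnC.
have E1 : poch (c * x r0) (i.+1 + msize K) = poch (c * x r0) i.+1 * poch d (msize K).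
  exact: pochD_eq.
have E2 : poch (c * x r0) (msize K) = poch (c * x r0) i.+1 * poch d (msize k).
  by rewrite KE; exact: pochD_eq.
rewrite /vwp (bigD1 r0) //= [in RHS](bigD1 r0) //= zE add0n j0 E1 E2.
rewrite [X in _ * X * _ = _](_ : _ = \prod_(r < n | r != r0)
  (th (c * x r * q ^+ (K r + msize K)) * poch (b * x r * q ^ ((K r)%:Z - (msize K)%:Z) / c) (N r - K r)
    * (poch (c * x r) (j r + msize K) / poch (c * x r) (N r + msize K).+1))); first by ring.
by apply: eq_bigr => r /j1 jr; rewrite zE jr.
Qed.

(** At the node c q x_r / d is q^{-i} x_r / x_{r0}, so the factors of [flank]
    replace the entries of the column r0 of the type A product. *)
Lemma typeA_point k : mle k N0 ->
  typeA x (madd k j) j * typeA x N mzero *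
    \prod_(r < n) poch (c * q * x r * q ^+ madd k j r / d) (N r - madd k j r) =
  typeA x N j * typeA x (madd k j) mzero *
    \prod_(r < n) poch (c' * q * x' r * q ^+ k r / d) (N0 r - k r).
Proof.
move=> /mleP kN; rewrite /typeA -!big_split; apply: eq_bigr => r _ /=.
have Kr : madd k j r = (k r + j r)%N by rewrite ffunE.
rewrite Kr NE !subnDr !addnK.
rewrite zE (bigD1 r0) //= [X in _ * X * _ = _](bigD1 r0) //=.
rewrite [in RHS](bigD1 r0) //= [X in _ = _ * X * _](bigD1 r0) //=.
rewrite zE !subn0 j0.
set z := q ^ (1 + (j r)%:Z - i.+1%:Z) * x r / x r0.
set y := q ^ (1 + 0%:Z - 0%:Z) * x r / x r0.
set A := \prod_(s < n | s != r0) _; set B := \prod_(s < n | s != r0) _.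
set A' := \prod_(s < n | s != r0) _; set B' := \prod_(s < n | s != r0) _.
(* E1 and E2 treat the column s = r0, E3 all the others. *)
have E1 : poch z (N0 r) = poch z (k r) * poch (c * q * x r * q ^+ (k r + j r) / d) (N0 r - k r).
  rewrite -{1}(subnKC (kN r)); apply: pochD_eq.
  rewrite /z /d expfzDr // [q ^ (1 + _)]expfzDr // expr1z -exprnN -exprnP exprD.
  by field; rewrite c0 !x0 !qX.
have E2 : poch y (N0 r + j r) = poch y (k r + j r) * poch (c' * q * x' r * q ^+ k r / d) (N0 r - k r).
  rewrite -{1}(subnKC (kN r)) addnAC; apply: pochD_eq.
  rewrite /y /d /c' /x' /shift subr0 addr0 expr1z exprD.
  by field; rewrite c0 !x0 !qX.
have E3 : A * B = A' * B'.
  rewrite /A /B /A' /B' -!big_split; apply: eq_bigr => s /j1 js /=.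
  rewrite js zE subr0 subr0 addr0 expr1z.
  have E : q ^ (1 + (j r)%:Z) * x r / x s = q * x r / x s * q ^+ j r.
    by rewrite expfzDr // expr1z -exprnP; field; exact: x0.
  rewrite addnC (pochD_eq _ _ E) [(k r + _)%N]addnC (pochD_eq _ _ E); ring.
rewrite E1 E2.
transitivity (poch z (k r) * (A * B) * (poch y (k r + j r) *
  poch (c' * q * x' r * q ^+ k r / d) (N0 r - k r)) *
  poch (c * q * x r * q ^+ (k r + j r) / d) (N0 r - k r)); first by ring.
by rewrite E3; ring.
Qed.

Definition step_factor e f : F :=
  typeD b x j j * powers b c x j * (typeA x N j / typeA x N mzero) * (poch e i.+1 * poch f i.+1).

Let cE : c * q ^+ msize j = c'. Proof. by rewrite jsize. Qed.

Let typeAN k : typeA x (madd k j) j = typeA x' k mzero.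
Proof. by rewrite -[X in typeA _ _ X](add0m j) typeA_shift. Qed.

(** On the terms that survive at the node, the summand is a constant multiple of
    a summand for N0; d is kept while e and f are multiplied by q^{i+1}. *)
Lemma summand_point k e f : mle k N0 -> e != 0 -> f != 0 ->
  summand b c x N d e f (madd k j) =
  step_factor e f * summand b c' x' N0 d (e * q ^+ i.+1) (f * q ^+ i.+1) k.
Proof.
move=> kN e0 f0; rewrite /summand /weight /step_factor.
rewrite typeD_shift // powers_shift // (@flank_shift _ th _ _ q0 c x N0 k j _ e0)
  (@flank_shift _ th _ _ q0 c x N0 k j _ f0) cE jsize -/x'.
have V := vwp_point k.
rewrite {2}/N vwp_shift // in V; last exact: generic_poch gen.
have X := typeA_point kN; rewrite cE -/x' in V.
have S1 : flank c x N (madd k j) d = poch d (msize (madd k j)) *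
    \prod_(r < n) poch (c * q * x r * q ^+ madd k j r / d) (N r - madd k j r) by [].
have S2 : flank c' x' N0 k d = poch d (msize k) *
    \prod_(r < n) poch (c' * q * x' r * q ^+ k r / d) (N0 r - k r) by [].
rewrite S1 S2 => {S1 S2}.
rewrite typeAN in X.
have n1 : typeA x N mzero != 0 := generic_typeA q0 _ _ gen.
have n2 : typeA x (madd k j) mzero != 0 := generic_typeA q0 _ _ gen.
have gen' : generic b c' x' by rewrite -cE; exact: generic_shift.
have n3 : typeA x' N0 k != 0 := generic_typeA q0 _ _ gen'.
have n4 : typeA x' k mzero != 0 := generic_typeA q0 _ _ gen'.
have -> : typeA x N (madd k j) = typeA x' N0 k by rewrite /N typeA_shift.
move: V X; set PD := \prod_(r < n) _; set PD' := \prod_(r < n) _ => V X.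
have E : vwp b c x N (madd k j) mzero * (poch d (msize (madd k j)) * PD) / typeA x (madd k j) mzero =
  vwp b c' x' N0 k mzero * (poch d (msize k) * PD') / typeA x' k mzero * (typeA x N j / typeA x N mzero).
  rewrite !mulrA V -!mulrA; congr (_ * (_ * _)).
  apply: (mulIf n1); apply: (mulIf n2); apply: (mulIf n4).
  transitivity (typeA x' k mzero * typeA x N mzero * PD); first by field.
  by rewrite X; field; rewrite n1 n4.
move: E n1 n2 n3 n4; move: (vwp b c x N _ _) (vwp b c' x' _ _ _) (poch d _) (poch d _).
move: (typeA x N j) (typeA x N mzero) (typeA x (madd k j) mzero) (typeA x' N0 k) (typeA x' k mzero).
move: (typeD _ _ _ _) (typeD _ _ _ _) (powers _ _ _ _) (powers _ _ _ _) (flank _ _ _ _ _) (flank _ _ _ _ _).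
move=> s1 s2 m1 m2 f1 f2 a1 a2 a3 a4 a5 v1 v2 p2 p1 E n1 n2 n3 n4.
transitivity (v1 * (p1 * PD) / a3 * (s1 * s2 / a4 * (m1 * m2) * (poch e i.+1 * f1 * (poch f i.+1 * f2)))).
  by field; rewrite n2 n3.
by rewrite E; field; rewrite n1 n3 n4.
Qed.

Lemma typeD_point : typeD b x N mzero * \prod_(r < n) poch (b * d * x r / c) (N r) =
  typeD b x j j * (typeD b x' N0 mzero * \prod_(r < n) poch (b * d * x' r / c') (N0 r)).
Proof.
rewrite [in RHS]mulrA -typeD_shift // add0m -/N /typeD.
set D := \prod_(r < n) \prod_(s < n | (r < s)%N) poch (b * x r * x s) (j r + j s).
have D1 : \prod_(r < n) \prod_(s < n | (r < s)%N) poch (b * x r * x s) (mzero r + mzero s) = 1.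
  by rewrite big1 // => r _; rewrite big1 // => s _; rewrite !zE poch0.
(* j vanishes outside r0, so only the pairs through r0 contribute. *)
have DE : D = \prod_(s < n | s != r0) poch (b * x r0 * x s) i.+1.
  rewrite /D (@prod_pairs_through _ _ r0 (fun r s => poch (b * x r * x s) (j r + j s))).
  - by apply: eq_bigr => s /j1 ->; rewrite j0 addn0.
  - by move=> r s; rewrite addnC; congr (poch _ _); ring.
  - by move=> r s /j1 -> /j1 ->; rewrite poch0.
have Dn0 : D != 0.
  rewrite DE; apply/prodf_neq0 => s sr0; apply: poch_neq0 => l _.
  by have [_ _ h _] := gen; apply: h; rewrite eq_sym.
rewrite D1 divr1 mulrAC; apply: (mulIf Dn0); rewrite divfK //.
rewrite [X in X * _ * _](bigD1 r0) //= [X in _ = X * _](bigD1 r0) //=.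
have E1 : \prod_(r < n | r != r0) \prod_(s < n) poch (b * x r * x s) (N s + j r) =
    \prod_(r < n | r != r0) \prod_(s < n) poch (b * x r * x s) (N s + mzero r).
  by apply: eq_bigr => r /j1 jr; apply: eq_bigr => s _; rewrite jr zE.
rewrite E1; set T := \prod_(r < n | r != r0) _.
suff : \prod_(s < n) poch (b * x r0 * x s) (N s + mzero r0) * D *
    \prod_(r < n) poch (b * d * x r / c) (N r) =
  \prod_(s < n) poch (b * x r0 * x s) (N s + j r0) *
    \prod_(r < n) poch (b * d * x' r / c') (N0 r).
  by move=> E; transitivity (T * (\prod_(s < n) poch (b * x r0 * x s) (N s + mzero r0) * D *
    \prod_(r < n) poch (b * d * x r / c) (N r))); [ring|rewrite E; ring].
have E2 : \prod_(s < n) poch (b * x r0 * x s) (N s + mzero r0) * D =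
  \prod_(s < n) poch (b * x r0 * x s) i.+1 * \prod_(r < n) poch (b * d * x' r / c') (N0 r).
  rewrite DE (bigD1 r0) //= [X in _ = X * _](bigD1 r0) //= [X in _ = _ * X](bigD1 r0) //=.
  set T0 := \prod_(s < n | s != r0) poch _ i.+1.
  have -> : poch (b * x r0 * x r0) (N r0 + mzero r0) =
      poch (b * x r0 * x r0) i.+1 * poch (b * d * x' r0 / c') (N0 r0).
    rewrite zE addn0 NE j0 addnC; apply: pochD_eq.
    by rewrite /d /c' /x' /shift j0; field; rewrite c0 !qX.
  have -> : \prod_(s < n | s != r0) poch (b * x r0 * x s) (N s + mzero r0) =
      \prod_(s < n | s != r0) poch (b * d * x' s / c') (N0 s).
    apply: eq_bigr => s sr0; rewrite zE addn0 NE (j1 sr0) addn0.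
    congr (poch _ _); rewrite /d /c' /x' /shift (j1 sr0) expr0.
    by field; rewrite c0 !qX.
  by ring.
rewrite E2 -mulrA [X in _ * X]mulrC mulrA; congr (_ * _).
rewrite -big_split; apply: eq_bigr => s _ /=; rewrite j0 addnC.
apply/esym/pochD_eq; rewrite /d; field; exact: c0.
Qed.

(** The balancing condition at the node reads b e x_{r0} / c = 1 / (f q^i) and
    symmetrically, so the extra factors are reflections of (e)_{i+1} and
    (f)_{i+1}. *)
Lemma conjugate_point e f : e != 0 -> f != 0 -> b * d * e * f = c ^+ 2 * q ->
  \prod_(r < n) (poch (b * e * x r / c) (N r) * poch (b * f * x r / c) (N r)) =
  powers b c x j * (poch e i.+1 * poch f i.+1) *
  \prod_(r < n) (poch (b * (e * q ^+ i.+1) * x' r / c') (N0 r) *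
                 poch (b * (f * q ^+ i.+1) * x' r / c') (N0 r)).
Proof.
move=> e0 f0 bal.
have split t : \prod_(r < n) poch (b * t * x r / c) (N r) = poch (b * t * x r0 / c) i.+1 *
    \prod_(r < n) poch (b * (t * q ^+ i.+1) * x' r / c') (N0 r).
  transitivity (\prod_(r < n) (poch (b * t * x r / c) (j r) *
      poch (b * (t * q ^+ i.+1) * x' r / c') (N0 r))).
    apply: eq_bigr => r _; rewrite NE addnC; apply: pochD_eq.
    by rewrite /c' /x' /shift; field; rewrite c0 !qX.
  rewrite big_split /= (bigD1 r0) //= j0 big1 ?mulr1 // => r /j1 ->.
  exact: poch0.
(* The balancing condition with d = c x_{r0} q^{i+1} inserted. *)
have bal' : e * f * (b * x r0 * q ^+ i) = c.
  have cq0 : c * q != 0 by rewrite mulf_neq0.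
  apply: (mulIf cq0); transitivity (b * d * e * f); last by rewrite bal; ring.
  by rewrite /d exprS; ring.
have Ee : b * e * x r0 / c = (f * q ^+ i)^-1.
  by rewrite -bal'; field; rewrite e0 f0 b0 x0 qX.
have Ef : b * f * x r0 / c = (e * q ^+ i)^-1.
  by rewrite -bal'; field; rewrite e0 f0 b0 x0 qX.
have powersE : powers b c x j = (b * x r0 / c) ^+ i.+1.
  rewrite /powers jsize mcross_point invr1 mulr1 (bigD1 r0) //= j0 big1 ?mulr1 => [|r /j1 ->].
    by rewrite -exprMn mulrAC.
  by rewrite expr0.
have refl : (\prod_(l < i.+1) - (f * q ^+ l)^-1) * (\prod_(l < i.+1) - (e * q ^+ l)^-1) =
    powers b c x j.
  have signs t : \prod_(l < i.+1) - (t * q ^+ l)^-1 =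
      (-1) ^+ i.+1 * (\prod_(l < i.+1) (t * q ^+ l))^-1.
    rewrite -prodfV -[X in (-1) ^+ X]card_ord -prodr_const -big_split.
    by apply: eq_bigr => l _ /=; rewrite mulN1r.
  rewrite !signs mulrACA -exprMn mulrNN mulr1 expr1n mul1r -invfM.
  rewrite (prod_reflect (t := c / (b * x r0))).
    by rewrite -exprVn powersE; congr (_ ^+ _); field; rewrite c0 b0 x0.
  by rewrite -bal'; field; rewrite b0 x0.
rewrite !big_split /= !split Ee Ef !poch_reflect // -refl; ring.
Qed.

Lemma closed_form_point e f : e != 0 -> f != 0 -> b * d * e * f = c ^+ 2 * q ->
  closed_form b c x N d e f =
  step_factor e f * closed_form b c' x' N0 d (e * q ^+ i.+1) (f * q ^+ i.+1).
Proof.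
move=> e0 f0 bal.
have n1 : typeA x N mzero != 0 := generic_typeA q0 _ _ gen.
have n2 : typeA x N j != 0 := generic_typeA q0 _ _ gen.
have E0 C y M e1 f1 : closed_form b C y M d e1 f1 =
    \prod_(r < n) poch (b * d * y r / C) (M r) *
    \prod_(r < n) (poch (b * e1 * y r / C) (M r) * poch (b * f1 * y r / C) (M r)) *
    typeD b y M mzero / typeA y M mzero.
  rewrite /closed_form -big_split /=; congr (_ * _ / _).
  by apply: eq_bigr => r _; rewrite -mulrA.
rewrite !E0 (conjugate_point e0 f0 bal) /step_factor.
have -> : typeA x' N0 mzero = typeA x N j by rewrite -typeAN.
set P := \prod_(r < n) poch (b * d * x r / c) (N r).
set P' := \prod_(r < n) poch (b * d * x' r / c') (N0 r).
set Q := \prod_(r < n) _; have := typeD_point; rewrite -/P -/P'.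
move: (typeD b x N _) (typeD b x j _) (typeD b x' N0 _) => s1 s2 s3 E.
transitivity (powers b c x j * (poch e i.+1 * poch f i.+1) * Q * (s1 * P) / typeA x N mzero).
  by field.
by rewrite E; field; rewrite n1 n2.
Qed.

Lemma Jackson_step e f : e != 0 -> f != 0 -> b * d * e * f = c ^+ 2 * q ->
  Jackson_sum b c' x' N0 d (e * q ^+ i.+1) (f * q ^+ i.+1) ->
  Jackson_sum b c x N d e f.
Proof.
move=> e0 f0 bal IH; rewrite /Jackson_sum closed_form_point // -IH mulr_sumr.
rewrite (bigID (mle j)) /= [X in _ + X]big1_seq ?addr0 => [|k /andP[jk]]; last first.
  by rewrite mem_box => kN; rewrite /summand flank_vanish // !mul0r mulr0.
rewrite box_shift; apply: eq_big_seq => k; rewrite mem_box => kN.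
exact: summand_point.
Qed.

End Step.
End Reduction.

(** * The elliptic D_n Jackson sum *)

Section Interpolation.
Variables (F : fieldType) (th : F -> F) (q : F) (n : nat).
Hypotheses (q0 : q != 0) (th1 : th 1 = 0).
Hypothesis thV : forall a : F, a != 0 -> th a^-1 = - a^-1 * th a.
Hypothesis th_rank2 : exists K : F, exists A B : F -> F, K != 0 /\
  forall X Y, X != 0 -> Y != 0 ->
  K * (th X * th Y) = A (X * Y) * B (X / Y) - Y * (B (X * Y) * A (X / Y)).
Hypothesis th_generic : forall s : seq F, (forall t, t \in s -> t != 0) ->
  exists2 d : F, d != 0 & forall t, t \in s -> th (d * t) != 0.
Implicit Types (a b c d e f lam : F) (x : 'I_n -> F) (j k N : multi n) (r s : 'I_n).

Local Notation poch := (poch th q).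
Local Notation flank := (flank th q).
Local Notation summand := (summand th q).
Local Notation closed_form := (closed_form th q).
Local Notation Jackson_sum := (Jackson_sum th q).
Local Notation generic := (generic th q).

Let qX m : q ^+ m != 0. Proof. by rewrite expf_neq0. Qed.

(** Nonproportionality of the values at d and d' of the two functions spanning
    the products theta (t d) theta (t lam / d). *)
Definition indep lam d d' := (th (d * d' / lam) != 0) && (th (d / d') != 0).

(** For fixed lam the products theta (t d) theta (t lam / d) have constant
    product of arguments, so [theta_rank2] applies; the wronskian of the two
    spanning functions is, by the same formula, a product of two thetas. *)
Lemma theta_plane lam : lam != 0 -> exists u v : F -> F,
  (forall t, t != 0 -> form u v 1 (fun d => th (t * d) * th (t * lam / d))) /\
  (forall d d', d != 0 -> d' != 0 -> indep lam d d' -> wronskian u v d d' != 0).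
Proof.
move=> l0; have [K [A [B [K0 AB]]]] := th_rank2.
exists (fun d => B (d ^+ 2 / lam)), (fun d => A (d ^+ 2 / lam) / d); split.
  move=> t t0; apply: form_ext (form_linear _ _ (K^-1 * A (t ^+ 2 * lam)) (- (K^-1 * t * lam * B (t ^+ 2 * lam)))).
  move=> d d0 /=; apply: (mulfI K0); rewrite AB ?mulf_neq0 ?invr_eq0 //.
  have -> : t * d * (t * lam / d) = t ^+ 2 * lam by field.
  have -> : t * d / (t * lam / d) = d ^+ 2 / lam by field; rewrite d0 t0 l0.
  by field; rewrite d0 K0.
move=> d d' d0 d0' /andP[h1 h2].
have : K * (th (d * d' / lam) * th (d / d')) != 0 by rewrite !mulf_neq0.
rewrite AB ?mulf_neq0 ?invr_eq0 //.
have -> : d * d' / lam * (d / d') = d ^+ 2 / lam by field; rewrite d0' l0.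
have -> : d * d' / lam / (d / d') = d' ^+ 2 / lam by field; rewrite d0 d0' l0.
apply: contraNneq => W; apply/eqP.
transitivity (- d * (B (d ^+ 2 / lam) * (A (d' ^+ 2 / lam) / d') -
  B (d' ^+ 2 / lam) * (A (d ^+ 2 / lam) / d))); first by field; rewrite d0 d0'.
by move: W; rewrite /wronskian => ->; rewrite mulr0.
Qed.

Section Forms.
Variables (u v : F -> F) (lam : F).
Hypothesis l0 : lam != 0.
Hypothesis phi : forall t, t != 0 -> form u v 1 (fun d => th (t * d) * th (t * lam / d)).

Lemma poch_form t m : t != 0 ->
  form u v m (fun d => poch (t * d) m * poch (t * lam / d) m).
Proof.
move=> t0; have -> : m = (\sum_(i < m) 1)%N by rewrite sum1_card card_ord.
apply: (@form_ext _ _ _ _ (fun d => \prod_(i < m) (th (t * q ^+ i * d) * th (t * q ^+ i * lam / d)))).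
  move=> d d0; rewrite sum1_card card_ord big_split /=.
  by congr (_ * _); apply: eq_bigr => i _; congr th; ring.
apply: form_prod => i; apply: phi.
by rewrite mulf_neq0.
Qed.

Lemma poch_form_inv C m : C != 0 ->
  form u v m (fun d => poch (C / d) m * poch (C / (lam / d)) m).
Proof.
move=> C0; apply: form_ext (poch_form m (t := C / lam) _); last first.
  by rewrite mulf_neq0 ?invr_eq0.
move=> d d0; rewrite mulrC; congr (poch _ _ * poch _ _); by field; rewrite ?d0 l0.
Qed.

Lemma flank_form c x N k : c != 0 -> (forall r, x r != 0) -> mle k N ->
  form u v (msize N) (fun d => flank c x N k d * flank c x N k (lam / d)).
Proof.
move=> c0 x0 /mleP kN.
have -> : msize N = (msize k + \sum_(r < n) (N r - k r))%N.
  by rewrite /msize -big_split; apply: eq_bigr => r _ /=; rewrite subnKC.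
pose G r d := poch (c * q * x r * q ^+ k r / d) (N r - k r) *
  poch (c * q * x r * q ^+ k r / (lam / d)) (N r - k r).
apply: (@form_ext _ _ _ _ (fun d => (poch (1 * d) (msize k) * poch (1 * lam / d) (msize k)) *
   \prod_(r < n) G r d)).
  by move=> d d0; rewrite /flank /G big_split /= !mul1r; ring.
apply: form_mul; first by apply: poch_form; exact: oner_neq0.
by apply: form_prod => r; apply: poch_form_inv; rewrite !mulf_neq0.
Qed.

Lemma closed_form_form b c x N e : b != 0 -> c != 0 -> (forall r, x r != 0) ->
  form u v (msize N) (fun d => closed_form b c x N d e (lam / d)).
Proof.
move=> b0 c0 x0.
apply: (@form_ext _ _ _ _ (fun d => (\prod_(r < n) poch (b * e * x r / c) (N r) *
    typeD th q b x N (mzero n) / typeA th q x N (mzero n)) *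
   \prod_(r < n) (poch (b * x r / c * d) (N r) * poch (b * x r / c * lam / d) (N r)))).
  move=> d d0; rewrite /closed_form !big_split /=.
  have E t : \prod_(r < n) poch (b * t * x r / c) (N r) =
      \prod_(r < n) poch (b * x r / c * t) (N r).
    by apply: eq_bigr => r _; congr (poch _ _); ring.
  rewrite (E d) (E (lam / d)).
  have -> : \prod_(r < n) poch (b * x r / c * lam / d) (N r) =
      \prod_(r < n) poch (b * x r / c * (lam / d)) (N r).
    by apply: eq_bigr => r _; congr (poch _ _); ring.
  by ring.
apply: form_scale; apply: form_prod => r; apply: poch_form.
by rewrite !mulf_neq0 ?invr_eq0.
Qed.

End Forms.

(** Both sides are forms of degree |N| in d, so |N| + 1 points suffice. *)
Lemma Jackson_interpolation b c x N e lam (S : seq F) :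
  generic b c x -> lam != 0 -> size S = (msize N).+1 ->
  (forall d, d \in S -> d != 0) -> pairwise (indep lam) S ->
  (forall d, d \in S -> Jackson_sum b c x N d e (lam / d)) ->
  forall d, d != 0 -> Jackson_sum b c x N d e (lam / d).
Proof.
move=> [[b0 c0 x0] _ _ _] l0 sS S0 pS JS d d0.
have [u [v [phi W]]] := theta_plane l0.
pose G t := \sum_(k <- box N) summand b c x N t e (lam / t) k +
  (-1) * closed_form b c x N t e (lam / t).
have hG : form u v (msize N) G.
  apply: form_add; last by apply: form_scale; exact: closed_form_form.
  apply: form_sum => k; rewrite mem_box => kN.
  apply: form_ext (form_scale (weight th q b c x N k * flank c x N k e) (flank_form l0 phi c0 x0 kN)).
  by move=> t t0; rewrite /summand; ring.
have pW : pairwise (fun t t' => wronskian u v t t' != 0) S.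
  apply: (sub_in_pairwise (P := [in S])) pS; last exact/allP.
  by move=> t t' tS tS'; apply: W; apply: S0.
have GS t : t \in S -> G t = 0.
  by move=> tS; rewrite /G (JS t tS) mulN1r subrr.
have := form_eq0 hG sS S0 pW GS d0.
by rewrite /G mulN1r => /eqP; rewrite subr_eq0 => /eqP.
Qed.

(** The condition on e under which the nodes are pairwise independent. *)
Definition generic_third b c x N e : Prop :=
  (forall r i, (i < N r)%N -> th (b * e * q ^+ i * x r / c) != 0) /\
  (forall r s i l, (i < N r)%N -> (l < N s)%N ->
     th (b * e * q ^+ (i + l).+1 * x r * x s) != 0).

(** The points at which the sum in d is known: it collapses at 1, and at the
    others it reduces to a smaller N. *)
Definition nodes c x N : seq F :=
  1 :: [seq c * x (tag p) * q ^+ (tagged p).+1 | p : {r : 'I_n & 'I_(N r)}].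

Lemma size_nodes c x N : size (nodes c x N) = (msize N).+1.
Proof. by rewrite /nodes /= size_image card_tagged sumnE big_map big_enum; congr _.+1;
  apply: eq_bigr => r _; rewrite card_ord. Qed.

Lemma th_inv_neq0 a : a != 0 -> th a != 0 -> th a^-1 != 0.
Proof. by move=> a0 h; rewrite thV // mulf_neq0 // oppr_eq0 invr_eq0. Qed.

Lemma indep_nodes b c x N e lam : generic b c x -> e != 0 -> lam != 0 ->
  b * e * lam = c ^+ 2 * q -> generic_third b c x N e ->
  pairwise (indep lam) (nodes c x N).
Proof.
move=> [[b0 c0 x0] cx _ xx] e0 l0 bal [g1 g2].
have lamV : lam^-1 = b * e / (c ^+ 2 * q).
  by rewrite -bal; field; rewrite b0 e0 l0.
rewrite /nodes pairwise_cons; apply/andP; split.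
  apply/allP => t /fintype.imageP[[r [l lN]] _ ->] /=; apply/andP; split.
    rewrite mul1r lamV (_ : _ * _ = b * e * q ^+ l * x r / c) ?g1 //.
    by rewrite exprS; field; rewrite q0 c0.
  by rewrite div1r th_inv_neq0 ?mulf_neq0.
rewrite /image_mem pairwise_map; have := enum_uniq (mem {: {r : 'I_n & 'I_(N r)}}); rewrite uniq_pairwise.
apply: sub_pairwise => -[r [l lN]] [s [m mN]] /= ne; apply/andP; split.
  rewrite (_ : _ / lam = b * e * q ^+ (l + m).+1 * x r * x s) ?g2 //.
  by rewrite lamV !exprS exprD; field; rewrite q0 c0.
rewrite (_ : _ / _ = q ^ (l%:Z - m%:Z) * x r / x s).
  apply: xx; have [rs|//] := eqVneq r s; rewrite orFb; subst s; apply: contra ne => lm.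
  by apply/eqP; congr existT; apply: val_inj => /=; lia.
by rewrite expfzDr // -exprnN -exprnP !exprS; field; rewrite c0 x0 qX q0.
Qed.

Lemma Jackson_generic_third N :
  (forall N' b c x d e f, (msize N' < msize N)%N -> generic b c x ->
    d != 0 -> e != 0 -> f != 0 -> b * d * e * f = c ^+ 2 * q ->
    Jackson_sum b c x N' d e f) ->
  forall b c x d e f, generic b c x -> generic_third b c x N e ->
    d != 0 -> e != 0 -> f != 0 -> b * d * e * f = c ^+ 2 * q ->
    Jackson_sum b c x N d e f.
Proof.
move=> IH b c x d e f gen gt d0 e0 f0 bal; have [[b0 c0 x0] _ _ _] := gen.
have l0 : d * f != 0 by rewrite mulf_neq0.
have bal' : b * e * (d * f) = c ^+ 2 * q by rewrite -bal; ring.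
have -> : f = d * f / d by field.
apply: (Jackson_interpolation gen l0 (size_nodes c x N) _ (indep_nodes gen e0 l0 bal' gt)) => //.
  move=> t; rewrite inE => /orP[/eqP->|/fintype.imageP[p _ ->]]; first exact: oner_neq0.
  by rewrite !mulf_neq0.
move=> t; rewrite inE => /orP[/eqP->|/fintype.imageP[[r [i iN]] _ ->] /=].
  by rewrite divr1; apply: Jackson_at1.
have [|N0 NE] := @mle_addP _ (mpoint r i.+1) N.
  by apply/mleP => s; rewrite ffunE; case: eqP => // ->.
set d' := c * x r * q ^+ i.+1.
have d'0 : d' != 0 by rewrite !mulf_neq0.
have f'0 : d * f / d' != 0 by rewrite mulf_neq0 ?invr_eq0.
have balt : b * d' * e * (d * f / d') = c ^+ 2 * q by rewrite -bal'; field.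
rewrite NE; apply: Jackson_step => //.
have cE : c * q ^+ i.+1 = c * q ^+ msize (mpoint r i.+1) by rewrite msize_point.
apply: IH; rewrite ?mulf_neq0 //.
- by rewrite NE msizeD msize_point; lia.
- by rewrite cE; apply: generic_shift.
- by rewrite invr_eq0.
- transitivity (b * d' * e * (d * f / d') * (q ^+ i.+1 * q ^+ i.+1)); first by rewrite -/d'; ring.
  by rewrite balt; ring.
Qed.

Lemma independent_points lam (T : seq F) m : lam != 0 -> (forall t, t \in T -> t != 0) ->
  exists S : seq F, [/\ size S = m, forall d, d \in S -> d != 0, pairwise (indep lam) S &
    forall d t, d \in S -> t \in T -> th (d * t) != 0].
Proof.
move=> l0 T0; elim: m => [|m [S [sS S0 pS ST]]]; first by exists [::].
have [|d d0 hd] := @th_generic (T ++ [seq t / lam | t <- S] ++ [seq t^-1 | t <- S]).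
  move=> t; rewrite !mem_cat => /or3P[/T0 //|/mapP[t' /S0 h ->]|/mapP[t' /S0 h ->]].
    by rewrite mulf_neq0 // invr_eq0.
  by rewrite invr_eq0.
exists (d :: S); split=> /=.
- by rewrite sS.
- by move=> t; rewrite inE => /orP[/eqP->|/S0].
- rewrite pS andbT; apply/allP => t tS; apply/andP; split.
    rewrite -mulrA hd // !mem_cat; apply/or3P/Or32.
    by apply/mapP; exists t.
  rewrite hd // !mem_cat; apply/or3P/Or33.
  by apply/mapP; exists t.
- move=> t t'; rewrite inE => /orP[/eqP->|tS] tT; last exact: ST.
  by rewrite hd // !mem_cat tT.
Qed.

(** Genericity in e is the nonvanishing of finitely many values theta (e t). *)
Lemma generic_third_dense b c x N : b != 0 -> c != 0 -> (forall r, x r != 0) ->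
  exists2 T : seq F, (forall t, t \in T -> t != 0) &
    forall e, (forall t, t \in T -> th (e * t) != 0) -> generic_third b c x N e.
Proof.
move=> b0 c0 x0; pose I := {r : 'I_n & 'I_(N r)}.
exists ([seq b * q ^+ tagged p * x (tag p) / c | p : I] ++
        [seq b * q ^+ (tagged p.1 + tagged p.2).+1 * x (tag p.1) * x (tag p.2) | p : I * I]).
  move=> t; rewrite mem_cat => /orP[] /fintype.imageP[p _ ->]; by rewrite !mulf_neq0 ?invr_eq0.
move=> e he; split.
  move=> r i iN; rewrite (_ : _ / _ = e * (b * q ^+ i * x r / c)); last by ring.
  apply: he; rewrite mem_cat; apply/orP; left; apply/fintype.imageP.
  by exists (existT _ r (Ordinal iN)).
move=> r s i l iN lN.
rewrite (_ : _ * x s = e * (b * q ^+ (i + l).+1 * x r * x s)); last by ring.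
apply: he; rewrite mem_cat; apply/orP; right; apply/fintype.imageP.
by exists (existT _ r (Ordinal iN), existT _ s (Ordinal lN)).
Qed.

(** The genericity of the fixed parameter is removed by a second interpolation:
    at generic points d the sum holds with the roles of d and e exchanged. *)
Theorem Jackson_sum_Dn N b c x d e f : generic b c x ->
  d != 0 -> e != 0 -> f != 0 -> b * d * e * f = c ^+ 2 * q ->
  Jackson_sum b c x N d e f.
Proof.
have [m] := ubnP (msize N); elim: m N b c x d e f => // m IHm N b c x d e f Nm gen d0 e0 f0 bal.
have IH N' b' c' x' d' e' f' : (msize N' < msize N)%N -> generic b' c' x' ->
    d' != 0 -> e' != 0 -> f' != 0 -> b' * d' * e' * f' = c' ^+ 2 * q ->
    Jackson_sum b' c' x' N' d' e' f'.
  by move=> lt; apply: IHm; lia.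
have [[b0 c0 x0] _ _ _] := gen.
have [T T0 hT] := generic_third_dense N b0 c0 x0.
have l0 : d * f != 0 by rewrite mulf_neq0.
have [S [sS S0 pS ST]] := independent_points (msize N).+1 l0 T0.
have -> : f = d * f / d by field.
apply: (Jackson_interpolation gen l0 sS S0 pS) => // t tS.
(* Now t is the fixed parameter, and it was chosen generic. *)
apply: Jackson_sum_sym; apply: (Jackson_generic_third IH) => //.
- by apply: hT => t' tT; apply: ST.
- exact: S0.
- by rewrite mulf_neq0 // invr_eq0; exact: S0.
- by rewrite -bal; field; exact: S0.
Qed.

End Interpolation.

(** * From the Jackson sum to the Bailey transform *)

#[local] Arguments qpfact : simpl never.

Section Bridge.
Variables (C : numFieldType) (n : nat) (q p : C) (x : 'I_n -> C).
Hypotheses (q0 : q != 0) (x0 : forall r, x r != 0).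
Implicit Types (a b : C) (j k N : multi n) (r s : 'I_n).

Local Notation th := (theta p).
Local Notation poch := (poch th q).
Local Notation typeA := (typeA th q).

Let qX m : q ^+ m != 0. Proof. by rewrite expf_neq0. Qed.

Lemma qpfact_nat a (m : nat) : qpfact q p a m = poch a m.
Proof. by []. Qed.

Lemma qpfact_sub a (m l : nat) : (l <= m)%N -> qpfact q p a (m%:Z - l%:Z) = poch a (m - l).
Proof. by move=> lm; rewrite subzn. Qed.

Lemma qpfact_neg a (t : nat) : qpfact q p a (- t%:Z) = (poch (a * q ^- t) t)^-1.
Proof.
case: t => [|t]; first by rewrite oppr0 qpfact_nat !poch0 invr1.
rewrite -NegzE /qpfact /poch (reindex_inj rev_ord_inj) /=; congr (_^-1).
apply: eq_bigr => i _; congr (theta _ _).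
have it : (i <= t)%N by rewrite -ltnS.
have E : q ^+ t.+1 = q ^+ (t - i).+1 * q ^+ i by rewrite -exprD addSn subnK.
by rewrite subSS E; field; rewrite !qX.
Qed.

(** At a negative index the factorial is the inverse of a product ending just
    before a; multiplying it by the next m factors cancels that product from
    the left. *)
Lemma qpfact_neg_shift a (t m : nat) : qpfact q p a (- t%:Z) != 0 ->
  qpfact q p a (m%:Z - t%:Z) = qpfact q p a (- t%:Z) * poch (a * q ^- t) m.
Proof.
rewrite qpfact_neg invr_eq0; case/orP: (leq_total t m) => le.
  have [m' ->] : exists m', m = (t + m')%N by exists (m - t)%N; rewrite subnKC.
  rewrite qpfact_sub ?leq_addr // addKn => nz.
  by rewrite (pochD_eq _ _ (a' := a)) ?mulKf //; field; rewrite qX.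
have [t' ->] : exists t', t = (m + t')%N by exists (t - m)%N; rewrite subnKC.
rewrite (_ : m%:Z - (m + t')%:Z = - t'%:Z); last by lia.
rewrite qpfact_neg (pochD_eq _ _ (a' := a * q ^- t')); last first.
  by rewrite exprD; field; rewrite !qX.
rewrite mulf_eq0 negb_or => /andP[n1 n2].
by field; rewrite n1 n2.
Qed.

Lemma xfact_typeA k j : mle j k -> xfact q p x k j = typeA x k j.
Proof.
move=> /mleP jk; apply: eq_bigr => r _; apply: eq_bigr => s _.
by rewrite qpfact_sub.
Qed.

Lemma poch_factor_neq0 a m i : poch a m != 0 -> (i < m)%N -> th (a * q ^+ i) != 0.
Proof. by move=> /prodf_neq0 h im; apply: (h (Ordinal im)). Qed.

Hypothesis thV : forall a, a != 0 -> th a^-1 = - a^-1 * th a.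

(** Each such theta value is a factor of [xfact] for suitable multi-indices; a
    negative exponent is reduced to a positive one by inversion. *)
Lemma generic_x_theta : generic_x q p x ->
  forall r s (i : int), (r != s) || (i != 0) -> th (q ^ i * x r / x s) != 0.
Proof.
move=> gx.
have pos r s (i : nat) : th (q ^ i.+1%:Z * x r / x s) != 0.
  pose k := mpoint r i.+1; have := gx (mzero n) k (mle0 k).
  rewrite xfact_typeA ?mle0 // => /prodf_neq0/(_ r isT)/prodf_neq0/(_ s isT).
  rewrite !ffunE eqxx subn0 subr0 addr0 expr1z => /poch_factor_neq0/(_ (ltnSn i)).
  by rewrite (_ : _ * q ^+ i = q ^ i.+1%:Z * x r / x s) // -exprnP exprS; ring.
move=> r s [[|i]|i] rsi; last 1 first.
- rewrite NegzE; have := pos s r i.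
  have z0 : q ^ i.+1%:Z * x s / x r != 0.
    by rewrite !mulf_neq0 ?invr_eq0 // -exprnP qX.
  rewrite (_ : _ / x s = (q ^ i.+1%:Z * x s / x r)^-1).
    by move=> h; rewrite thV // mulf_neq0 // oppr_eq0 invr_eq0.
  by rewrite -exprnN -exprnP; field; rewrite !x0 qX.
(* Exponent 0 and r <> s: with j the unit vector at s, 1 + j_r - j_s = 0. *)
- pose j := mpoint s 1; pose k := madd (mpoint r 1) j.
  have rs : r != s by move: rsi; rewrite eqxx orbF.
  have := gx j k (mle_addl _ _); rewrite xfact_typeA ?mle_addl //.
  move=> /prodf_neq0/(_ r isT)/prodf_neq0/(_ s isT).
  rewrite !ffunE !eqxx (negPf rs) => /poch_factor_neq0/(_ (ltnSn 0)).
  by rewrite expr0 mulr1.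
- exact: pos.
Qed.

End Bridge.

Section Transformation.
Variables (C : numFieldType) (n : nat) (q p : C) (x : 'I_n -> C) (rho1 rho2 a b : C).
Hypotheses (q0 : q != 0) (x0 : forall r, x r != 0).
Hypotheses (rho10 : rho1 != 0) (rho20 : rho2 != 0).
Hypothesis gx : generic_x q p x.
Hypothesis gab : generic_ab q p x rho1 rho2 a b.

Local Notation th := (theta p).
Hypothesis th1 : th 1 = 0.
Hypothesis thV : forall t : C, t != 0 -> th t^-1 = - t^-1 * th t.
Hypothesis th_rank2 : exists K : C, exists A B : C -> C, K != 0 /\
  forall X Y, X != 0 -> Y != 0 ->
  K * (th X * th Y) = A (X * Y) * B (X / Y) - Y * (B (X * Y) * A (X / Y)).
Hypothesis th_generic : forall s : seq C, (forall t, t \in s -> t != 0) ->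
  exists2 d : C, d != 0 & forall t, t \in s -> th (d * t) != 0.

Local Notation poch := (poch th q).
Local Notation typeA := (typeA th q).
Local Notation vwp := (vwp th q).
Local Notation typeD := (typeD th q).
Local Notation powers := (powers q).
Local Notation flank := (flank th q).
Local Notation summand := (summand th q).
Local Notation closed_form := (closed_form th q).
Local Notation shift := (shift q).
Local Notation mzero := (mzero n).

Let qX m : q ^+ m != 0. Proof. by rewrite expf_neq0. Qed.
Let a0 : a != 0. Proof. by have [[]] := gab. Qed.
Let b0 : b != 0. Proof. by have [[]] := gab. Qed.

Let c := b * rho1 * rho2 / (a * q).
Let f := c / a.

Let c0 : c != 0. Proof. by rewrite !mulf_neq0 ?invr_eq0 // mulf_neq0. Qed.
Let f0 : f != 0. Proof. by rewrite mulf_neq0 ?invr_eq0. Qed.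

Lemma generic_transformed : generic th q b c x.
Proof.
have [_ g1 g2 g3 _] := gab; split; first by split.
- move=> r [|i].
    rewrite expr0 mulr1 (_ : c * x r = b * rho1 * rho2 * x r / (a * q)) ?g2 //.
    by rewrite /c; ring.
  have [_ _ _ h] := g1 r i.+1.
  have := poch_factor_neq0 h (ltnSn i).
  rewrite (_ : _ * q ^+ i = c * x r * q ^+ i.+1) //.
  by rewrite /c exprS; field; rewrite a0 q0.
- move=> r s i; rewrite -val_eqE /= neq_ltn => /orP[rs|sr].
    exact: poch_factor_neq0 (g3 r s i.+1 rs) (ltnSn i).
  have := poch_factor_neq0 (g3 s r i.+1 sr) (ltnSn i).
  by rewrite (_ : b * x s * x r = b * x r * x s) //; ring.
- exact: generic_x_theta.
Qed.

Definition beta_prefactor (N : multi n) : C :=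
  \prod_(r < n) (qpfact q p (b * rho1 * x r / a) (N r) * qpfact q p (b * rho2 * x r / a) (N r)
    / (qpfact q p (a * x r * q / rho1) (N r) * qpfact q p (a * x r * q / rho2) (N r))).

Definition beta_coef (N k : multi n) : C :=
  qpfact q p rho1 (msize k) * qpfact q p rho2 (msize k)
  / (\prod_(r < n)
       (qpfact q p (b * rho1 * x r / a) (k r) * qpfact q p (b * rho2 * x r / a) (k r)))
  * (\prod_(r < n)
       (theta p (b * rho1 * rho2 * x r * q ^+ (k r + msize k) / (a * q))
        / theta p (b * rho1 * rho2 * x r / (a * q))
        * (qpfact q p (a * x r * q ^ (1 + (k r)%:Z - (msize k)%:Z)
             / (rho1 * rho2)) ((N r)%:Z - (k r)%:Z)
           / qpfact q p (b * rho1 * rho2 * x r / a) (N r + msize k)%N)))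
  * ((\prod_(r < n) \prod_(s < n) qpfact q p (b * x r * x s) (N s + k r)%N)
     / ((\prod_(r < n) \prod_(s < n | (r < s)%N)
           qpfact q p (b * x r * x s) (k r + k s)%N)
        * xfact q p x N k))
  * (a * q / (rho1 * rho2)) ^+ msize k
  * (\prod_(r < n) x r ^+ k r) * q ^- mcross k.

Definition scale (N0 j : multi n) : C := let N := madd N0 j in
  (\prod_(r < n) (poch (a * x r * q / rho1) (N r) * poch (a * x r * q / rho2) (N r)
     * poch (a * x r * q) (N r + msize j)))^-1
  * typeD b x j j * powers b c x j * (poch rho1 (msize j) * poch rho2 (msize j)).

Let bcE : a * q / (rho1 * rho2) = b / c.
Proof. by rewrite /c; field; rewrite rho10 rho20 a0 b0 q0. Qed.

(** The prefactor of beta' clears the denominators belonging to rho1 and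
    rho2. *)
Lemma flank_rho rho rho' (N K : multi n) : rho != 0 -> mle K N -> c * q * rho^-1 = b * rho' / a ->
  (forall r m, poch (b * rho' * x r / a) m != 0) ->
  poch rho (msize K) * \prod_(r < n) (poch (b * rho' * x r / a) (N r) / poch (b * rho' * x r / a) (K r))
  = flank c x N K rho.
Proof.
move=> r0 /mleP KN cE nz; congr (_ * _); apply: eq_bigr => r _.
rewrite -{1}(subnKC (KN r)) (pochD_eq _ _ (a' := c * q * x r * q ^+ K r / rho)).
  by rewrite mulrC mulKf.
by transitivity (c * q * rho^-1 * x r * q ^+ K r); [ring|rewrite cE; ring].
Qed.

Lemma vwp_beta_coef (N K j : multi n) : mle K N ->
  \prod_(r < n)
       (theta p (b * rho1 * rho2 * x r * q ^+ (K r + msize K) / (a * q))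
        / theta p (b * rho1 * rho2 * x r / (a * q))
        * (qpfact q p (a * x r * q ^ (1 + (K r)%:Z - (msize K)%:Z)
             / (rho1 * rho2)) ((N r)%:Z - (K r)%:Z)
           / qpfact q p (b * rho1 * rho2 * x r / a) (N r + msize K)%N))
  * \prod_(r < n) (qpfact q p (c * x r) (j r + msize K)%N
                   / qpfact q p (a * x r * q) (K r + msize j)%N)
  = vwp b c x N K j * \prod_(r < n) (poch (a * x r * q) (K r + msize j))^-1.
Proof.
move=> /mleP KN; rewrite /vwp -!big_split; apply: eq_bigr => r _ /=.
rewrite qpfact_sub // !qpfact_nat pochS.
have -> : b * rho1 * rho2 * x r * q ^+ (K r + msize K) / (a * q) = c * x r * q ^+ (K r + msize K).
  by rewrite /c; ring.
have -> : b * rho1 * rho2 * x r / (a * q) = c * x r by rewrite /c; ring.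
have -> : b * rho1 * rho2 * x r / a = c * x r * q by rewrite /c; field; rewrite a0 q0.
have -> : a * x r * q ^ (1 + (K r)%:Z - (msize K)%:Z) / (rho1 * rho2) =
    b * x r * q ^ ((K r)%:Z - (msize K)%:Z) / c.
  rewrite -addrA [q ^ (1 + _)]expfzDr // expr1z.
  transitivity (a * q / (rho1 * rho2) * x r * q ^ ((K r)%:Z - (msize K)%:Z)); first by ring.
  by rewrite bcE; ring.
by rewrite [(th _ * _)^-1]invfM; ring.
Qed.

(** The first factor of B1 at (a, c) is (c / a)_{|k|-|j|}, so f = c / a is the
    third free parameter, and the denominators (a q x_r)_m of B1 are its own. *)
Lemma flank_third (N0 k j : multi n) : mle k N0 ->
  poch f (msize k) * \prod_(r < n) (poch (a * x r * q) (madd k j r + msize j))^-1 =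
  flank (c * q ^+ msize j) (shift x j) N0 k f *
  \prod_(r < n) (poch (a * x r * q) (madd N0 j r + msize j))^-1.
Proof.
move=> /mleP kN; rewrite /flank -mulrA -big_split; congr (_ * _).
apply: eq_bigr => r _; rewrite /= !ffunE.
have -> : (N0 r + j r + msize j = (k r + j r + msize j) + (N0 r - k r))%N.
  by have := kN r; lia.
have E : poch (a * x r * q) (k r + j r + msize j + (N0 r - k r)) =
    poch (a * x r * q) (k r + j r + msize j) *
    poch (c * q ^+ msize j * q * shift x j r * q ^+ k r / f) (N0 r - k r).
  by apply: pochD_eq; rewrite /f /shift !exprD; field; rewrite a0 c0.
have nz : poch (a * x r * q) (k r + j r + msize j + (N0 r - k r)) != 0.
  have [_ g1 _ _ _] := gab.
  by have [] := g1 r (k r + j r + msize j + (N0 r - k r))%N.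
move: nz; rewrite E mulf_eq0 negb_or => /andP[n1 n2].
by field; rewrite n1 n2.
Qed.

(** For fixed j the terms with k >= j are, up to a constant, the summand of a
    Jackson sum with c = b rho1 rho2 / (a q), d = rho1 q^{|j|},
    e = rho2 q^{|j|} and f = c / a. *)
Lemma beta_coef_summand (N0 j k : multi n) : mle k N0 ->
  beta_prefactor (madd N0 j) * beta_coef (madd N0 j) (madd k j) * B1 q p x (madd k j) j a c =
  scale N0 j * summand b (c * q ^+ msize j) (shift x j) N0
    (rho1 * q ^+ msize j) (rho2 * q ^+ msize j) f k.
Proof.
move=> kN; set N := madd N0 j; set K := madd k j.
have KN : mle K N by rewrite mle_add2.
have jK : mle j K by exact: mle_addl.
have [_ g1 _ _ _] := gab.
have nz1 r m : poch (b * rho1 * x r / a) m != 0 by have [_ _ []] := g1 r m.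
have nz2 r m : poch (b * rho2 * x r / a) m != 0 by have [_ _ []] := g1 r m.
have H1 : poch rho1 (msize K) * \prod_(r < n) (poch (b * rho2 * x r / a) (N r) /
    poch (b * rho2 * x r / a) (K r)) = flank c x N K rho1.
  by apply: flank_rho => //; rewrite /c; field; rewrite rho10 a0 q0.
have H2 : poch rho2 (msize K) * \prod_(r < n) (poch (b * rho1 * x r / a) (N r) /
    poch (b * rho1 * x r / a) (K r)) = flank c x N K rho2.
  by apply: flank_rho => //; rewrite /c; field; rewrite rho20 a0 q0.
have H3 := @vwp_beta_coef N K j KN.
have H4 := flank_third j kN.
have H5 : beta_prefactor N * (qpfact q p rho1 (msize K) * qpfact q p rho2 (msize K)
  / (\prod_(r < n)
       (qpfact q p (b * rho1 * x r / a) (K r) * qpfact q p (b * rho2 * x r / a) (K r)))) =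
  flank c x N K rho1 * flank c x N K rho2 *
  (\prod_(r < n) (poch (a * x r * q / rho1) (N r) * poch (a * x r * q / rho2) (N r)))^-1.
  rewrite -H1 -H2 !qpfact_nat -!prodfV.
  rewrite [RHS](_ : _ = poch rho1 (msize K) * poch rho2 (msize K) *
    \prod_(r < n) ((poch (b * rho2 * x r / a) (N r) / poch (b * rho2 * x r / a) (K r)) *
      (poch (b * rho1 * x r / a) (N r) / poch (b * rho1 * x r / a) (K r)) *
      (poch (a * x r * q / rho1) (N r) * poch (a * x r * q / rho2) (N r))^-1)); last first.
    by rewrite !big_split /=; ring.
  rewrite mulrCA; congr (_ * _); rewrite /beta_prefactor -big_split; apply: eq_bigr => r _ /=.
  by rewrite !qpfact_nat !invfM; ring.
have gen := generic_transformed.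
rewrite /summand /weight /scale.
have <- : vwp b c x N K j = vwp b (c * q ^+ msize j) (shift x j) N0 k mzero.
  by apply: vwp_shift => //; exact: generic_poch gen.
have <- : typeA x N K = typeA (shift x j) N0 k by exact: typeA_shift.
have <- : typeA x K j = typeA (shift x j) k mzero.
  by rewrite -[X in typeA _ _ X](add0m j); exact: typeA_shift.
rewrite (@flank_shift _ th q _ q0 c x N0 k j _ rho10) in H5.
rewrite (@flank_shift _ th q _ q0 c x N0 k j _ rho20) in H5.
have Es : typeD b x N K = _ := typeD_shift th q0 b x N0 k j.
have Em : powers b c x K = _ := powers_shift q0 b x k j c0.
have fE : b * rho1 * rho2 / (a * q) / a = f by [].
have KjE : (msize K)%:Z - (msize j)%:Z = (msize k)%:Z by rewrite msizeD; lia.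
have EB : B1 q p x K j a c = poch f (msize k) / typeA x K j *
   \prod_(r < n) (qpfact q p (c * x r) (j r + msize K)%N / qpfact q p (a * x r * q) (K r + msize j)%N).
  by rewrite /B1 KjE xfact_typeA.
rewrite EB /beta_coef xfact_typeA // bcE.
set S2 := \prod_(r < n) _ in H3 *; set S3 := \prod_(r < n) _ in H3 *.
set X := typeA x N K; set X' := typeA x K j.
set Q := \prod_(r < n) (qpfact q p _ _ * _) in H5 *.
set T := \prod_(r < n) \prod_(s < n) _; set D := \prod_(r < n) \prod_(s < n | _) _.
have typeDE : typeD b x N K = T / D by [].
set g1' := _ ^+ msize K; set g2 := \prod_(r < n) x r ^+ K r; set g3 := q ^- _.
have powersE : powers b c x K = g1' * g2 * g3 by [].
transitivity ((beta_prefactor N * (qpfact q p rho1 (msize K) * qpfact q p rho2 (msize K) / Q)) *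
  (S2 * S3) * poch f (msize k) * (T / D) * (g1' * g2 * g3) * (X * X')^-1).
  by rewrite [(D * X)^-1]invfM [(X * X')^-1]invfM; ring.
rewrite H5 H3 -typeDE -powersE Es Em.
have -> : \prod_(r < n) (poch (a * x r * q / rho1) (N r) * poch (a * x r * q / rho2) (N r)
    * poch (a * x r * q) (N r + msize j)) =
  \prod_(r < n) (poch (a * x r * q / rho1) (N r) * poch (a * x r * q / rho2) (N r)) *
  \prod_(r < n) poch (a * x r * q) (N r + msize j) by rewrite big_split.
move: H4; rewrite [\prod_(r < n) (poch (a * x r * q) (madd N0 j r + _))^-1]prodfV.
set G := \prod_(r < n) (poch _ _)^-1; set G' := \prod_(r < n) poch (a * x r * q) _.
set A := \prod_(r < n) _ => H4.
transitivity (poch rho1 (msize j) * flank (c * q ^+ msize j) (shift x j) N0 k (rho1 * q ^+ msize j) *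
   (poch rho2 (msize j) * flank (c * q ^+ msize j) (shift x j) N0 k (rho2 * q ^+ msize j)) / A *
   vwp b c x N K j * (poch f (msize k) * G) * (typeD b x j j * typeD b (shift x j) N0 k) *
   (powers b c x j * powers b (c * q ^+ msize j) (shift x j) k) / (X * X')); first by ring.
by rewrite H4 [(A * G')^-1]invfM; ring.
Qed.

Definition alpha_coef (j : multi n) : C :=
  qpfact q p rho1 (msize j) * qpfact q p rho2 (msize j)
  / (\prod_(r < n) (qpfact q p (a * x r * q / rho1) (j r) * qpfact q p (a * x r * q / rho2) (j r)))
  * (a * q / (rho1 * rho2)) ^+ msize j
  * (\prod_(r < n) x r ^+ j r) * q ^- mcross j.

(** The three products of the right-hand side of the Jackson sum are the tails
    of (a q x_r / rho2), (a q x_r / rho1) and of the quotient of the factorials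
    (b x_r / a) in B4. *)
Lemma closed_form_B4 (N0 j : multi n) :
  scale N0 j * closed_form b (c * q ^+ msize j) (shift x j) N0
    (rho1 * q ^+ msize j) (rho2 * q ^+ msize j) f =
  B4 q p x (madd N0 j) j a b * alpha_coef j.
Proof.
set N := madd N0 j; have [_ g1 _ _ g5] := gab.
have jN : mle j N by exact: mle_addl.
have jle r : (j r <= msize j)%N by rewrite /msize (bigD1 r) //= leq_addr.
have NE r : N r = (j r + N0 r)%N by rewrite ffunE addnC.
have A1 r : poch (a * x r * q / rho1) (N r) = poch (a * x r * q / rho1) (j r) *
    poch (b * (rho2 * q ^+ msize j) * shift x j r / (c * q ^+ msize j)) (N0 r).
  rewrite NE; apply: pochD_eq; rewrite /shift /c.
  by field; rewrite rho10 rho20 a0 b0 q0 !qX.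
have A2 r : poch (a * x r * q / rho2) (N r) = poch (a * x r * q / rho2) (j r) *
    poch (b * (rho1 * q ^+ msize j) * shift x j r / (c * q ^+ msize j)) (N0 r).
  rewrite NE; apply: pochD_eq; rewrite /shift /c.
  by field; rewrite rho10 rho20 a0 b0 q0 !qX.
have A3 r : qpfact q p (b * x r / a) ((N r)%:Z - (msize j)%:Z) =
    qpfact q p (b * x r / a) ((j r)%:Z - (msize j)%:Z) *
    poch (b * f * shift x j r / (c * q ^+ msize j)) (N0 r).
  (* j_r - |j| = - t is never positive. *)
  pose t := (msize j - j r)%N.
  have jt : msize j = (j r + t)%N by rewrite /t subnKC.
  have E : (j r)%:Z - (msize j)%:Z = - t%:Z by rewrite jt; lia.
  have nz := g5 j r; rewrite E in nz *.
  have -> : (N r)%:Z - (msize j)%:Z = (N0 r)%:Z - t%:Z by rewrite NE jt; lia.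
  rewrite (qpfact_neg_shift q0 _ nz); congr (_ * poch _ _).
  by rewrite /f /shift jt exprD; field; rewrite a0 c0 !qX.
have n1 r m : poch (a * x r * q / rho1) m != 0 by have [_ []] := g1 r m.
have n2 r m : poch (a * x r * q / rho2) m != 0 by have [_ []] := g1 r m.
have typeDE : typeD b x j j * typeD b (shift x j) N0 mzero =
  (\prod_(r < n) \prod_(s < n) qpfact q p (b * x r * x s) (N r + j s)%N) /
  (\prod_(r < n) \prod_(s < n | (r < s)%N) qpfact q p (b * x r * x s) (j r + j s)%N).
  rewrite -typeD_shift // add0m -/N; congr (_ / _).
  rewrite exchange_big; apply: eq_bigr => r _; apply: eq_bigr => s _.
  by rewrite qpfact_nat; congr (poch _ _); ring.
have typeAE : typeA (shift x j) N0 mzero = xfact q p x N j.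
  rewrite xfact_typeA // -[X in _ = typeA _ _ X](add0m j) -typeA_shift //.
rewrite /scale /closed_form /alpha_coef /B4 bcE typeAE -/N.
set S := typeD _ _ _ j in typeDE *; set S' := typeD _ _ _ mzero in typeDE *.
set T := \prod_(r < n) \prod_(s < n) _ in typeDE *; set D := \prod_(r < n) \prod_(s < n | _) _ in typeDE *.
set X := xfact _ _ _ _ _; have powersE : powers b c x j = (b / c) ^+ msize j * (\prod_(r < n) x r ^+ j r) * q ^- mcross j by [].
rewrite powersE [(D * X)^-1]invfM -[(\prod_(r < n) (poch _ _ * _ * _))^-1]prodfV
  -[(\prod_(r < n) (qpfact q p _ _ * _))^-1]prodfV.
set P1 := \prod_(r < n) (poch _ _ * _ * _)^-1; set P2 := \prod_(r < n) (_ * _ * _).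
set P3 := \prod_(r < n) (_ / _); set P4 := \prod_(r < n) (_ * _)^-1.
have PE : P1 * P2 = P3 * P4.
  rewrite /P1 /P2 /P3 /P4 -!big_split; apply: eq_bigr => r _ /=.
  rewrite !qpfact_nat A3 A1 A2.
  have := n1 r (N r); rewrite A1 mulf_eq0 negb_or => /andP[m1 m2].
  have := n2 r (N r); rewrite A2 mulf_eq0 negb_or => /andP[m3 m4].
  have m5 : poch (a * x r * q) (N r + msize j) != 0 by have [] := g1 r (N r + msize j)%N.
  have m6 := g5 j r.
  by field; rewrite m1 m2 m3 m4 m5 m6.
rewrite !qpfact_nat.
transitivity ((P1 * P2) * (S * S') * ((b / c) ^+ msize j * (\prod_(r < n) x r ^+ j r) * q ^- mcross j) *
  (poch rho1 (msize j) * poch rho2 (msize j)) / X); first by ring.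
by rewrite PE typeDE; ring.
Qed.

(** Comparison of the coefficients of alpha_j in the claim, by the Jackson sum
    from j to N. *)
Lemma beta_coef_sum (N j : multi n) : mle j N ->
  beta_prefactor N * \sum_(k <- box N | mle j k) beta_coef N k * B1 q p x k j a c =
  B4 q p x N j a b * alpha_coef j.
Proof.
move=> /mle_addP[N0 ->]; rewrite -closed_form_B4 mulr_sumr.
rewrite box_shift.
rewrite (@eq_big_seq _ _ _ _ _ _ (fun k => scale N0 j * summand b (c * q ^+ msize j) (shift x j) N0
    (rho1 * q ^+ msize j) (rho2 * q ^+ msize j) f k)); last first.
  by move=> k; rewrite mem_box => kN; rewrite mulrA beta_coef_summand.
rewrite -mulr_sumr; congr (_ * _); apply: Jackson_sum_Dn => //.
- exact: generic_shift generic_transformed.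
- by rewrite mulf_neq0.
- by rewrite mulf_neq0.
- rewrite /f /c; field; exact/andP.
Qed.

Lemma WP_Bailey_transform (alpha beta : multi n -> C -> C -> C) :
  (forall N, beta N a c = box_sum N (fun j => B1 q p x N j a c * alpha j a c)) ->
  forall N, beta' q p x rho1 rho2 beta N a b =
    box_sum N (fun j => B4 q p x N j a b * alpha' q p x rho1 rho2 alpha j a b).
Proof.
move=> hB N; rewrite /beta' !box_sumE.
transitivity (beta_prefactor N * \sum_(k <- box N) beta_coef N k * beta k a c); first by [].
transitivity (beta_prefactor N * \sum_(k <- box N) \sum_(j <- box N | mle j k)
    beta_coef N k * (B1 q p x k j a c * alpha j a c)).
  congr (_ * _); apply: eq_big_seq => k; rewrite mem_box => kN.
  by rewrite hB box_sumE (box_sub _ kN) mulr_sumr.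
rewrite (exchange_big_dep predT) //= mulr_sumr; apply: eq_big_seq => j; rewrite mem_box => jN.
transitivity (beta_prefactor N * (\sum_(k <- box N | mle j k) beta_coef N k * B1 q p x k j a c) * alpha j a c).
  rewrite -mulrA mulr_suml; congr (_ * _); apply: eq_bigr => k _; exact: mulrA.
rewrite beta_coef_sum // -mulrA; congr (_ * _).
Qed.

End Transformation.

Theorem theorem8p3 (R : realType) (n : nat) (hn : (1 <= n)%N)
    (q p : R[i]) (hq : q != 0) (hp : `|p| < 1)
    (x : 'I_n -> R[i]) (hx : forall r, x r != 0) (hgx : generic_x q p x)
    (G : R[i] -> R[i] -> Prop) (alpha beta : multi n -> R[i] -> R[i] -> R[i])
    (hB1 : WP_Bailey_pair G (B1 q p x) alpha beta)
    (rho1 rho2 : R[i]) (hrho1 : rho1 != 0) (hrho2 : rho2 != 0) :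
  WP_Bailey_pair
    (fun a b : R[i] => generic_ab q p x rho1 rho2 a b /\
                G a (b * rho1 * rho2 / (a * q)))
    (B4 q p x) (alpha' q p x rho1 rho2 alpha) (beta' q p x rho1 rho2 beta).
Proof.
move=> a b [gab Gab].
apply: (@WP_Bailey_transform (Cx R) n q p x rho1 rho2 a b) => //.
- exact: (@theta1 R p hp).
- exact: (@theta_inv R p hp).
- exact: (@theta_rank2 R p hp).
- exact: (@theta_generic R p hp).
- by move=> N; apply: hB1.
Qed.
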